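(* Suppose $0<p<2$ and $\mu$ is a positive finite Borel measure on $[0,1)$. Then $\mathcal{H}_{\mu}(H^{\infty})\subseteq\mathcal{Q}_{p}$ if and only if $\mu$ is a Carleson measure.
   Context: $\mathbb{D}=\{z\in\mathbb{C}:|z|<1\}$ is the open unit disc, $H(\mathbb{D})$ is the space of analytic functions in $\mathbb{D}$, $H^\infty$ is the space of bounded analytic functions in $\mathbb{D}$, and $dA$ is area measure on $\mathbb{D}$. For a finite positive Borel measure $\mu$ on $[0,1)$ let $\mu_n=\int_{[0,1)}t^n\,d\mu(t)$ and $\mu_{n,k}=\mu_{n+k}$ for integers $n,k\ge 0$. For $f(z)=\sum_{k=0}^\infty a_kz^k\in H(\mathbb{D})$, the (generalized) Hilbert operator is $$\mathcal{H}_\mu(f)(z)=\sum_{n=0}^\infty\Big(\sum_{k=0}^\infty \mu_{n,k}a_k\Big)z^n,\quad z\in\mathbb{D},$$ whenever the terms on the right-hand side make sense (each inner series converges) and the resulting function is analytic in $\mathbb{D}$. The inclusion $\mathcal{H}_\mu(H^\infty)\subseteq\mathcal{Q}_p$ means that for every $f\in H^\infty$, $\mathcal{H}_\mu(f)$ is well defined in this sense and belongs to $\mathcal{Q}_p$. For $0\le p<\infty$, $\mathcal{Q}_p$ is the set of $f\in H(\mathbb{D})$ with $$\|f\|_{\mathcal{Q}_p}^2=\sup_{w\in\mathbb{D}}\int_{\mathbb{D}}|f'(z)|^2(1-|\sigma_w(z)|^2)^p\,dA(z)<\infty,\qquad \sigma_w(z)=\frac{w-z}{1-\bar w z}.$$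 For $0<s<\infty$, a positive Borel measure $\mu$ on $[0,1)$ is an $s$-Carleson measure if $\sup_{t\in[0,1)}\frac{\mu([t,1))}{(1-t)^s}<\infty$; a Carleson measure is a $1$-Carleson measure. *)

(* Defs.v *)
From HB Require Import structures.
From mathcomp Require Import all_boot all_order all_algebra.
From mathcomp Require Import complex.
From mathcomp Require Import all_classical all_reals all_analysis.

Set Implicit Arguments.
Unset Strict Implicit.
Unset Printing Implicit Defensive.

Import Order.TTheory GRing.Theory Num.Theory numFieldNormedType.Exports.

Local Open Scope ring_scope.
Local Open Scope complex_scope.
Local Open Scope classical_set_scope.

(* The library attaches the topology of a [numClosedFieldType] to an abstract
   field only. These instances transport it to [R[i]], which thereby is a normed
   space over itself: [derivable f z 1] and [derive1 f z] are then complex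
   differentiability and the complex derivative. *)
HB.instance Definition _ (R : realType) :=
  PseudoPointedMetric.copy R[i] R[i]^o.
HB.instance Definition _ (R : realType) := GRing.ComAlgebra.copy R[i] R[i]^o.
HB.instance Definition _ (R : realType) := Vector.copy R[i] R[i]^o.
HB.instance Definition _ (R : realType) := NormedModule.copy R[i] R[i]^o.

Section Disc.
Variable R : realType.
Implicit Types (f : R[i] -> R[i]) (a : nat -> R[i]) (z w : R[i]).

(* The library norm on [R[i]] takes values in [R[i]]; this one is real. *)
Definition modulus z : R := Normc.normc z.

Definition disc : set R[i] := [set z | modulus z < 1].

Definition analytic f : Prop := forall z, disc z -> derivable f z 1.

Definition Hinfty f : Prop :=
  analytic f /\ exists M : R, forall z, disc z -> modulus (f z) <= M.

Definition has_expansion f a : Prop :=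
  forall z, disc z -> series (fun k => a k * z ^+ k) @ \oo --> f z.

Definition dA : set (measurableTypeR R * measurableTypeR R) -> \bar R :=
  (@lebesgue_measure R \x @lebesgue_measure R)%E.

Definition area_integral (h : R[i] -> \bar R) : \bar R :=
  (\int[dA]_(u in [set u | disc (u.1 +i* u.2)]) h (u.1 +i* u.2))%E.

Definition sigma w z : R[i] := (w - z) / (1 - w^* * z).

Definition Qnorm2 (p : R) f : \bar R :=
  ereal_sup [set area_integral (fun z =>
    (modulus (derive1 f z) ^+ 2 * (1 - modulus (sigma w z) ^+ 2) `^ p)%:E)
  | w in disc].

Definition Qspace (p : R) f : Prop := analytic f /\ (Qnorm2 p f < +oo)%E.

End Disc.

Section Hilbert.
Variable R : realType.
Variable mu : {finite_measure set (measurableTypeR R) -> \bar R}.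
Implicit Types (f : R[i] -> R[i]) (a : nat -> R[i]) (z : R[i]).

Definition carleson (s : R) : Prop :=
  (ereal_sup [set mu `[t, 1%R[ * ((1 - t) `^ s)^-1%:E | t in `[0%R, 1%R[]
    < +oo)%E.

Definition moment (n : nat) : R := \int[mu]_(t in `[0, 1[) t ^+ n.

Definition hilbert_term a (n k : nat) : R[i] := (moment (n + k))%:C * a k.

Definition hilbert_coef a (n : nat) : R[i] := limn (series (hilbert_term a n)).

(* [limn] is total: the values below are meaningful under
   [hilbert_well_defined]. *)
Definition hilbert_op a z : R[i] :=
  limn (series (fun n => hilbert_coef a n * z ^+ n)).

Definition hilbert_well_defined a : Prop :=
  [/\ forall n, cvgn (series (hilbert_term a n)),
      forall z, disc z -> cvgn (series (fun n => hilbert_coef a n * z ^+ n))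
    & analytic (hilbert_op a)].

(* An analytic function on the disc has exactly one sequence [a] of Taylor
   coefficients at 0, and the operator depends on [f] through [a]. *)
Definition hilbert_maps_Hinfty_into (X : (R[i] -> R[i]) -> Prop) : Prop :=
  forall f a, Hinfty f -> has_expansion f a ->
    hilbert_well_defined a /\ X (hilbert_op a).

End Hilbert.

(* Main.v *)
(** For bounded [f] the operator is a Cauchy transform:
    [H_mu f (z) = \int f(t) / (1 - t z) dmu(t)], so that
    [(H_mu f)' (z) = \int t f(t) / (1 - t z)^2 dmu(t)].

    If [mu] is Carleson then [mu_n = O(1/n)] and
    [|(H_mu f)' (z)| <= C \int |1 - t z|^-2 dmu(t) = O(1 / |1 - z|)]. Since
    [1 - |sigma_w z|^2] is at most [16] times the smaller of [|1 - z| / |1 - w|]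
    and its inverse, summing over dyadic annuli around 1 bounds the area
    integrals uniformly in [w]. The integral representation holds because the
    Taylor coefficients of [f] are square summable (a discrete Parseval identity
    on circles), so that they are summable against the moments.

    Conversely, already [f = 1] suffices: for real [r] close to 1,
    [Re (H_mu 1)' >= c mu([r, 1)) / (1 - r)^2] on a disc of radius comparable to
    [1 - r] around [r], where moreover [|sigma_r|] is small; the area integral at
    [w = r] is therefore at least [c (mu([r, 1)) / (1 - r))^2]. *)
Require Import Defs.
From mathcomp Require Import all_boot all_order all_algebra.
From mathcomp Require Import cyclic separable cyclotomic.
From mathcomp Require Import complex.
From mathcomp Require Import all_classical all_reals all_analysis.
From mathcomp Require Import measurable_realfun.
From mathcomp Require Import ring lra.

Set Implicit Arguments.
Unset Strict Implicit.
Unset Printing Implicit Defensive.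

Import Order.TTheory GRing.Theory Num.Theory numFieldNormedType.Exports.

Local Open Scope ring_scope.
Local Open Scope classical_set_scope.

(** * Modulus and convergence in [R[i]] *)

(** The delicate point of the direct half is the interchange of sum and integral: a bound
    [|a_k| <= M] against moments of size [1 / k] only leaves a harmonic series. Square summability
    supplies what is missing and makes [\sum |a_k| t ^ k] a [mu]-integrable majorant, so that
    dominated convergence applies. Averaging over roots of unity keeps Parseval a finite algebraic
    identity, with no integral over a circle.

    The area integrands contain [derive1] of a function defined through [limn], and their
    measurability is never established. Both halves compare them with scaled indicators of squares,
    or countable sums of these, using that the integral of a nonnegative function is a supremum over
    the simple functions below it.

    Positivity of [p] enters as the ratio [2 ^ (- p)] between consecutive dyadic annuli, which makes
    the bound on the area integrals a convergent geometric series. *)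

Section modulus.
Variable R : realType.
Implicit Types (z w : R[i]) (x : R).

Lemma modulusE z : `|z| = (modulus z)%:C%C. Proof. by []. Qed.

Lemma modulus_ge0 z : 0 <= modulus z.
Proof. by rewrite -ler0c -modulusE. Qed.

Lemma modulus0 : modulus (0 : R[i]) = 0. Proof. exact: Normc.normc0. Qed.

Lemma modulus1 : modulus (1 : R[i]) = 1. Proof. exact: Normc.normc1. Qed.

Lemma modulus_eq0 z : (modulus z == 0) = (z == 0).
Proof. by apply/eqP/eqP => [/Normc.eq0_normc|->]//; exact: modulus0. Qed.

Lemma modulusM z w : modulus (z * w) = modulus z * modulus w.
Proof. exact: Normc.normcM. Qed.

Lemma modulusV z : modulus z^-1 = (modulus z)^-1.
Proof. exact: Normc.normcV. Qed.

Lemma modulusD z w : modulus (z + w) <= modulus z + modulus w.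
Proof. exact: le_normcD. Qed.

Lemma modulusN z : modulus (- z) = modulus z.
Proof. exact: normcN. Qed.

Lemma modulusBC z w : modulus (z - w) = modulus (w - z).
Proof. by rewrite -modulusN opprB. Qed.

Lemma modulusB_ge z w : modulus z - modulus w <= modulus (z - w).
Proof. by rewrite lerBlDr -{1}(subrK w z) modulusD. Qed.

Lemma modulusX z n : modulus (z ^+ n) = modulus z ^+ n.
Proof. by elim: n => [|n IH]; rewrite ?modulus1// !exprS modulusM IH. Qed.

Lemma modulus_real x : modulus x%:C%C = `|x|.
Proof. by rewrite /modulus /= expr0n addr0 sqrtr_sqr. Qed.

Lemma modulus_sum (I : Type) (r : seq I) (P : pred I) (F : I -> R[i]) :
  modulus (\sum_(i <- r | P i) F i) <= \sum_(i <- r | P i) modulus (F i).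
Proof.
elim/big_ind2 : _ => [|z a w b za wb|//]; first by rewrite modulus0.
by rewrite (le_trans (modulusD _ _))// lerD.
Qed.

Lemma sqr_modulus z : modulus z ^+ 2 = complex.Re z ^+ 2 + complex.Im z ^+ 2.
Proof.
by case: z => a b; rewrite /modulus /= sqr_sqrtr// addr_ge0// sqr_ge0.
Qed.

Lemma normRe_le_modulus z : `|complex.Re z| <= modulus z.
Proof.
by rewrite -ler_sqr ?nnegrE ?modulus_ge0// sqr_modulus real_normK ?num_real// lerDl sqr_ge0.
Qed.

Lemma normIm_le_modulus z : `|complex.Im z| <= modulus z.
Proof.
by rewrite -ler_sqr ?nnegrE ?modulus_ge0// sqr_modulus real_normK ?num_real// lerDr sqr_ge0.
Qed.

Lemma modulus_le_ReIm z : modulus z <= `|complex.Re z| + `|complex.Im z|.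
Proof.
rewrite -ler_sqr ?nnegrE ?modulus_ge0 ?addr_ge0// sqr_modulus sqrrD.
by rewrite !real_normK ?num_real// lerD2r lerDl mulrn_wge0// mulr_ge0.
Qed.

Lemma discE z : disc z = (modulus z < 1). Proof. by []. Qed.

Lemma disc_real x : 0 <= x -> disc x%:C%C = (x < 1).
Proof. by move=> x0; rewrite discE modulus_real ger0_norm. Qed.

End modulus.

Section convergence.
Variable R : realType.
Implicit Types (u : nat -> R[i]) (l : R[i]).

Lemma cvg_modulusP (T : Type) (F : set_system T) (FF : Filter F) (f : T -> R[i]) l :
  f @ F --> l <-> (fun x => modulus (f x - l)) @ F --> 0.
Proof.
split => [/cvgrPdist_lt h|/cvgrPdist_lt h].
  apply/cvgrPdist_lt => e e0; have := h e%:C%C; rewrite ltcR => /(_ e0).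
  apply: filterS => x; rewrite modulusE ltcR sub0r normrN ger0_norm ?modulus_ge0//.
  by rewrite modulusBC.
(* Radii are complex here; positivity in the order of [R[i]] forces the imaginary part [b] to
   vanish. *)
apply/cvgrPdist_lt => -[e b]; rewrite ltcE /= => /andP[/eqP -> e0].
have := h e e0; apply: filterS => x; rewrite modulusE ltcR sub0r normrN.
by rewrite ger0_norm ?modulus_ge0// modulusBC.
Qed.

Lemma cvg_ReImP (T : Type) (F : set_system T) (FF : Filter F) (f : T -> R[i]) l :
  f @ F --> l <-> (fun x => complex.Re (f x)) @ F --> complex.Re l /\
                  (fun x => complex.Im (f x)) @ F --> complex.Im l.
Proof.
split.
  move/cvg_modulusP/cvgrPdist_lt => h; split; apply/cvgrPdist_lt => e e0;
    have := h e e0; apply: filterS => x;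
    rewrite sub0r normrN ger0_norm ?modulus_ge0// modulusBC;
    apply: le_lt_trans.
    by have := normRe_le_modulus (l - f x); case: (l) (f x) => ? ? [].
  by have := normIm_le_modulus (l - f x); case: (l) (f x) => ? ? [].
move=> [/cvgrPdist_lt hR /cvgrPdist_lt hI].
apply/cvg_modulusP/cvgrPdist_lt => e e0.
have e20 : 0 < e / 2 by rewrite divr_gt0.
have := hI _ e20; have := hR _ e20; apply: filterS2 => x xR xI.
rewrite sub0r normrN ger0_norm ?modulus_ge0// modulusBC.
rewrite (le_lt_trans (modulus_le_ReIm _))// (splitr e).
move: xR xI; case: (l) (f x) => a b [c d] /= xR xI.
exact: ltrD.
Qed.

End convergence.

(** * Square summability of the Taylor coefficients *)

Section parseval.
Variable C : numClosedFieldType.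

(** [X^n - 1] splits and is separable in characteristic 0, so it has [n] distinct roots; [n]
    distinct [n]-th roots of unity in a field include a primitive one. *)
Lemma prim_root_exists n : (0 < n)%N -> exists w : C, n.-primitive_root w.
Proof.
pose p : {poly C} := 'X^n - 1; have [r Dp] := closed_field_poly_normal p.
move=> n_gt0; rewrite (monicP _) ?monicXnsubC // scale1r in Dp.
have rn1 : all n.-unity_root r by apply/allP=> z; rewrite -root_prod_XsubC -Dp.
have sz_r : (n < (size r).+1)%N.
  by rewrite -(size_prod_XsubC r id) -Dp size_XnsubC.
have [|z] := hasP (has_prim_root n_gt0 rn1 _ sz_r); last by exists z.
by rewrite -separable_prod_XsubC -Dp separable_Xn_sub_1 // pnatr_eq0 -lt0n.
Qed.

Lemma prim_root_norm n (w : C) : n.-primitive_root w -> `|w| = 1.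
Proof.
move=> wn; apply/eqP; rewrite -(@pexpr_eq1 _ _ n) ?(prim_order_gt0 wn)//.
by rewrite -normrX (prim_expr_order wn) normr1.
Qed.

(** Conjugation inverts [w ^+ l], so the summands are the powers of an [n]-th root of unity [u]. If
    [k] differs from [l] then [u != 1], and [u ^+ n - 1 = (u - 1) * \sum u ^+ j] makes the sum
    vanish. *)
Lemma prim_root_orthogonal n (w : C) (k l : 'I_n) : n.-primitive_root w ->
  \sum_(j < n) (w ^+ j) ^+ k * ((w ^+ j) ^+ l)^* = n%:R * (k == l)%:R.
Proof.
move=> wn; pose u := w ^+ k * (w ^+ l)^*.
have ww : w ^+ l * (w ^+ l)^* = 1 by rewrite -normCK normrX (prim_root_norm wn) !expr1n.
have -> : \sum_(j < n) (w ^+ j) ^+ k * ((w ^+ j) ^+ l)^* = \sum_(j < n) u ^+ j.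
  apply: eq_bigr => j _; rewrite /u exprMn -rmorphXn/=.
  by rewrite -!exprM mulnC [(j * l)%N]mulnC.
have [kl|kl] := eqVneq k l.
  by rewrite /u kl ww mulr1; under eq_bigr do rewrite expr1n; rewrite sumr_const card_ord.
rewrite mulr0; have u1 : u != 1.
  apply/eqP => /(congr1 (fun x => x * w ^+ l)); rewrite /u mul1r -mulrA.
  rewrite [X in _ * X]mulrC ww mulr1 => /eqP; rewrite (eq_prim_root_expr wn).
  by rewrite !modn_small// => /eqP/ord_inj/eqP; rewrite (negbTE kl).
apply/eqP; rewrite -(mulrI_eq0 _ (mulfI (_ : u - 1 != 0))) ?subr_eq0//.
rewrite -subrX1 /u exprMn -rmorphXn/= -!exprM ![(_ * n)%N]mulnC !exprM.
by rewrite (prim_expr_order wn) !expr1n conjC1 mulr1 subrr.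
Qed.

(** Expanding the squares, the average over the roots kills every cross term. This is exact because
    all exponents stay below the order of [w]. *)
Lemma discrete_parseval n (w : C) (c : nat -> C) : n.-primitive_root w ->
  \sum_(j < n) `|\sum_(k < n) c k * (w ^+ j) ^+ k| ^+ 2 =
  n%:R * \sum_(k < n) `|c k| ^+ 2.
Proof.
move=> wn; under eq_bigr => j _.
  rewrite normCK rmorph_sum mulr_suml /=.
  under eq_bigr do rewrite mulr_sumr.
  over.
rewrite exchange_big mulr_sumr; apply: eq_bigr => k _ /=.
rewrite exchange_big (bigD1 k)//= [X in _ + X]big1 ?addr0 => [|l lk].
  under eq_bigr do rewrite rmorphM mulrACA.
  by rewrite -mulr_sumr (prim_root_orthogonal k k wn) eqxx mulr1 -normCK mulrC.
under eq_bigr do rewrite rmorphM mulrACA.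
by rewrite -mulr_sumr (prim_root_orthogonal k l wn) eq_sym (negbTE lk) !mulr0.
Qed.

End parseval.

Section coefficients.
Variable R : realType.
Implicit Types (f : R[i] -> R[i]) (a : nat -> R[i]) (z w : R[i]).

Lemma geometric_tail_le (q : R) m n : 0 <= q -> q < 1 -> (m <= n)%N ->
  \sum_(m <= k < n) q ^+ k <= q ^+ m / (1 - q).
Proof.
move=> q0 q1 mn; rewrite ler_pdivlMr ?subr_gt0// mulr_suml.
under eq_bigr do rewrite mulrBr mulr1 -exprSr -opprB.
by rewrite sumrN telescope_sumr// opprB lerBlDr lerDl exprn_ge0.
Qed.

Lemma bernoulli_le (x : R) n : 0 <= x -> x <= 1 -> 1 - x *+ n <= (1 - x) ^+ n.
Proof.
move=> x0 x1; elim: n => [|n IH]; first by rewrite subr0.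
have := ler_wpM2l (_ : 0 <= 1 - x) IH; rewrite subr_ge0 => /(_ x1).
rewrite -exprS; apply: le_trans; rewrite mulrS.
have : 0 <= x * (x *+ n) by rewrite mulr_ge0// mulrn_wge0.
nra.
Qed.

(** The terms of a convergent series are bounded. Used at a radius beyond the circle of interest,
    this gives geometric tails uniform on that circle. *)
Lemma coef_bounded f a (r : R) : has_expansion f a -> 0 <= r -> r < 1 ->
  exists2 B : R, 0 < B & forall k, modulus (a k) * r ^+ k <= B.
Proof.
move=> fa r0 r1; have := fa r%:C%C.
rewrite disc_real// => /(_ r1) h.
have /cvg_series_cvg_0/cvg_modulusP h0 : cvgn (series (fun k => a k * r%:C%C ^+ k)).
  by apply/cvg_ex; exists (f r%:C%C).
have /cvg_seq_bounded/pinfty_ex_gt0[B B0 hB] :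
    cvgn (fun k => modulus (a k * r%:C%C ^+ k - 0)).
  by apply/cvg_ex; exists 0.
exists B => // k.
have : `|modulus (a k * r%:C%C ^+ k - 0)| <= B by exact: hB.
rewrite subr0 modulusM modulusX. rewrite modulus_real !ger0_norm//.
by rewrite mulr_ge0 ?modulus_ge0 ?exprn_ge0.
Qed.

(* The polynomials [\sum_(k < N) a k * z ^+ k] are bounded by [M + 2] on the
   circle of radius [r] once [N] is large, uniformly in [z]; the discrete
   Parseval identity then bounds their coefficients. *)
Lemma coef_square_summable f a (M : R) K : has_expansion f a ->
  (forall z, disc z -> modulus (f z) <= M) ->
  \sum_(k < K) modulus (a k) ^+ 2 <= 2 * (M + 2) ^+ 2.
Proof.
move=> fa fM; have M0 : 0 <= M.
  by rewrite (le_trans (modulus_ge0 (f 0)))// fM// discE modulus0.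
(* Close enough to 1 that Bernoulli gives [r ^+ (2 K) >= 1 - 2 K x >= 1/2]; undoing this weight
   costs the factor 2 of the conclusion. *)
pose x : R := (4 * K.+1%:R)^-1; pose r := 1 - x.
have x0 : 0 < x by rewrite invr_gt0 mulr_gt0// ltr0n.
have x1 : x <= 4^-1.
  by rewrite lef_pV2 ?posrE ?mulr_gt0 ?ltr0n// ler_peMr// ler1n.
have r0 : 0 < r by rewrite /r; lra.
have r1 : r < 1 by rewrite /r; lra.
have rK : 2^-1 <= r ^+ (K + K).
  apply: le_trans (bernoulli_le _ (ltW x0) _); last by lra.
  have : x *+ K <= 4^-1.
    rewrite -[x *+ K]mulr_natr /x invfM -mulrA ler_piMr// mulrC ler_pdivrMr ?ltr0n//.
    by rewrite mul1r ler_nat.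
  rewrite mulrnDr; lra.
(* Coefficients are [O(rho ^- k)], so on the circle of radius [r] the tails are geometric of ratio
   [q = r / rho], whatever the point. *)
pose rho := (1 + r) / 2.
have rho0 : 0 < rho by rewrite /rho; lra.
have rho1 : rho < 1 by rewrite /rho; lra.
have [B B0 aB] := coef_bounded fa (ltW rho0) rho1.
pose q := r / rho.
have q0 : 0 <= q by rewrite divr_ge0// ltW.
have q1 : q < 1 by rewrite ltr_pdivrMr// mul1r /rho; lra.
have [N KN qN] : exists2 N, (K < N)%N & B * (q ^+ N / (1 - q)) <= 1.
  have := @cvg_expr R q; rewrite ger0_norm// => /(_ q1)/cvgrPdist_lt.
  move=> /(_ ((1 - q) / B)); rewrite divr_gt0 ?subr_gt0// => /(_ isT)[N0 _ hN].
  exists (maxn N0 K.+1); rewrite ?leq_maxr//.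
  have := hN (maxn N0 K.+1) (leq_maxl _ _).
  rewrite sub0r normrN ger0_norm ?exprn_ge0// ltr_pdivlMr// => /ltW qN.
  by rewrite mulrA ler_pdivrMr ?subr_gt0// mul1r mulrC.
have zr z : modulus z = r -> modulus (\sum_(k < N) a k * z ^+ k) <= M + 2.
  move=> zr; have dz : disc z by rewrite discE zr.
  have /cvg_modulusP/cvgrPdist_lt/(_ _ ltr01)[N1 _ hN1] := fa z dz.
  (* The rank [N1] depends on [z] while [N] does not. The partial sum at [maxn N1 N] is within 1 of
     [f z], and cutting it back to [N] terms costs at most 1 more, whence [M + 2]. *)
  have := hN1 (maxn N1 N) (leq_maxl _ _).
  rewrite sub0r normrN ger0_norm ?modulus_ge0// => h1.
  have Nm : (N <= maxn N1 N)%N by rewrite leq_maxr.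
  move: h1; rewrite /series /= (big_cat_nat (leq0n N) Nm)/= big_mkord.
  set S1 := \sum_(k < N) _; set S2 := \sum_(N <= k < _) _ => h1.
  have S2B : modulus S2 <= 1.
    rewrite /S2 (le_trans (modulus_sum _ _ _))//; apply: le_trans qN.
    apply: le_trans (ler_wpM2l (ltW B0) (geometric_tail_le q0 q1 Nm)).
    rewrite mulr_sumr; apply: ler_sum => k _.
    rewrite modulusM modulusX zr /q expr_div_n mulrA ler_pdivlMr ?exprn_gt0//.
    by rewrite mulrAC ler_wpM2r ?exprn_ge0// ltW.
  have -> : S1 = (S1 + S2 - f z) + f z - S2 by ring.
  rewrite (le_trans (modulusD _ _))// modulusN.
  rewrite (le_trans (lerD (modulusD _ _) S2B))//.
  by have := fM z dz; lra.
have [w wN] := @prim_root_exists R[i] N (leq_ltn_trans (leq0n _) KN).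
have N0 : (0 < N%:R :> R) by rewrite ltr0n (leq_ltn_trans (leq0n _) KN).
have parseval : \sum_(j < N) modulus (\sum_(k < N) a k * (r%:C%C * w ^+ j) ^+ k) ^+ 2
    = N%:R * \sum_(k < N) (modulus (a k) * r ^+ k) ^+ 2.
  apply: complexI; rewrite rmorphM !rmorph_sum/= rmorph_nat.
  have h := discrete_parseval (fun k => a k * r%:C%C ^+ k) wN.
  transitivity (\sum_(j < N) `|\sum_(k < N) a k * r%:C%C ^+ k * (w ^+ j) ^+ k| ^+ 2).
    apply: eq_bigr => j _; rewrite modulusE -[RHS]rmorphXn; congr ((modulus _ ^+ 2)%:C)%C.
    by apply: eq_bigr => k _; rewrite exprMn mulrA.
  rewrite h; congr (_ * _); apply: eq_bigr => k _.
  by rewrite normrM modulusE normrX modulusE modulus_real ger0_norm ?ltW//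
    !rmorphXn rmorphM rmorphXn.
have le1 : \sum_(k < N) (modulus (a k) * r ^+ k) ^+ 2 <= (M + 2) ^+ 2.
  rewrite -(ler_pM2l N0) -parseval mulr_natl.
  rewrite -[N in leRHS]card_ord -sumr_const; apply: ler_sum => j _.
  rewrite ler_sqr ?nnegrE ?modulus_ge0 ?addr_ge0//; apply: zr.
  rewrite modulusM modulus_real ger0_norm ?ltW// modulusX.
  have -> : modulus w = 1 by apply: complexI; rewrite -modulusE (prim_root_norm wN).
  by rewrite expr1n mulr1.
apply: le_trans (ler_wpM2l (ltW (ltr0n R 2)) le1).
rewrite mulr_sumr.
rewrite -(big_mkord xpredT (fun k => modulus (a k) ^+ 2)).
rewrite -(big_mkord xpredT (fun k => 2 * (modulus (a k) * r ^+ k) ^+ 2)).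
rewrite [leRHS](big_cat_nat (leq0n K) (ltnW KN))/=.
rewrite -[leLHS]addr0 lerD//; last by apply: sumr_ge0 => k _; rewrite mulr_ge0// sqr_ge0.
rewrite !big_mkord; apply: ler_sum => k _; rewrite exprMn.
rewrite mulrCA ler_peMr ?sqr_ge0// -exprM muln2 -addnn.
have : r ^+ (K + K) <= r ^+ (k + k).
  by rewrite ler_wiXn2l ?ltW// leq_add// ltnW.
lra.
Qed.

End coefficients.

(** * Integrals of bounded complex functions *)

Section bounded_measurable.
Context d (T : measurableType d) (R : realType).
Variable D : set T.
Implicit Types (F G : T -> R[i]) (c : R[i]).

(** Boundedness is included so that the class is stable under products and, for a finite measure,
    consists of integrable functions. *)
Definition bmeas F : Prop :=
  [/\ measurable_fun D (fun t => complex.Re (F t)),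
      measurable_fun D (fun t => complex.Im (F t))
    & exists B : R, forall t, D t -> modulus (F t) <= B].

Lemma bmeas_cst c : bmeas (fun=> c).
Proof. by split; [exact: measurable_cst|exact: measurable_cst|exists (modulus c)]. Qed.

Lemma bmeas_real (h : T -> R) (B : R) : measurable_fun D h ->
  (forall t, D t -> `|h t| <= B) -> bmeas (fun t => (h t)%:C%C).
Proof.
move=> mh hB; split; [exact: mh|exact: measurable_cst|].
by exists B => t Dt; rewrite modulus_real hB.
Qed.

Lemma bmeasD F G : bmeas F -> bmeas G -> bmeas (fun t => F t + G t).
Proof.
move=> [F1 F2 [A FA]] [G1 G2 [B GB]]; split.
- rewrite (_ : (fun t => _) = (fun t => complex.Re (F t) + complex.Re (G t))).
    exact: measurable_funD.
  by apply/funext => t; case: (F t) (G t) => ? ? [].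
- rewrite (_ : (fun t => _) = (fun t => complex.Im (F t) + complex.Im (G t))).
    exact: measurable_funD.
  by apply/funext => t; case: (F t) (G t) => ? ? [].
- by exists (A + B) => t Dt; rewrite (le_trans (modulusD _ _))// lerD ?FA ?GB.
Qed.

Lemma bmeasM F G : bmeas F -> bmeas G -> bmeas (fun t => F t * G t).
Proof.
move=> [F1 F2 [A FA]] [G1 G2 [B GB]]; split.
- rewrite (_ : (fun t => _) = (fun t => complex.Re (F t) * complex.Re (G t)
      - complex.Im (F t) * complex.Im (G t))).
    by apply: measurable_funB; exact: measurable_funM.
  by apply/funext => t; case: (F t) (G t) => ? ? [].
- rewrite (_ : (fun t => _) = (fun t => complex.Re (F t) * complex.Im (G t)
      + complex.Im (F t) * complex.Re (G t))).
    by apply: measurable_funD; exact: measurable_funM.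
  by apply/funext => t; case: (F t) (G t) => ? ? [].
- exists (A * B) => t Dt; rewrite modulusM ler_pM ?modulus_ge0 ?FA ?GB//.
Qed.

Lemma bmeasX F n : bmeas F -> bmeas (fun t => F t ^+ n).
Proof.
move=> mF; elim: n => [|n IH]; first exact: bmeas_cst.
by under [X in bmeas X]funext do rewrite exprS; exact: bmeasM.
Qed.

Lemma bmeasB F G : bmeas F -> bmeas G -> bmeas (fun t => F t - G t).
Proof.
move=> mF mG; under [X in bmeas X]funext do rewrite -mulN1r.
by apply: bmeasD => //; apply: bmeasM => //; exact: bmeas_cst.
Qed.

Lemma bmeas_sum (F : nat -> T -> R[i]) m n : (forall k, bmeas (F k)) ->
  bmeas (fun t => \sum_(m <= k < n) F k t).
Proof.
move=> mF; elim: n => [|n IH].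
  by under [X in bmeas X]funext do rewrite big_geq//; exact: bmeas_cst.
have [mn|nm] := leqP m n; last first.
  by under [X in bmeas X]funext do rewrite big_geq//; exact: bmeas_cst.
by under [X in bmeas X]funext do rewrite big_nat_recr//=; exact: bmeasD.
Qed.

Lemma bmeas_lim (F : nat -> T -> R[i]) G (B : R) : (forall n, bmeas (F n)) ->
  (forall t, D t -> F ^~ t @ \oo --> G t) ->
  (forall t, D t -> modulus (G t) <= B) -> bmeas G.
Proof.
move=> mF FG GB; split; last by exists B.
- apply: (@measurable_fun_cvg _ _ _ _ (fun n t => complex.Re (F n t))).
    by move=> n; have [] := mF n.
  by move=> t /FG/cvg_ReImP[].
- apply: (@measurable_fun_cvg _ _ _ _ (fun n t => complex.Im (F n t))).
    by move=> n; have [] := mF n.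
  by move=> t /FG/cvg_ReImP[].
Qed.

End bounded_measurable.

Section complex_integral.
Context d (T : measurableType d) (R : realType).
Variables (mu : {finite_measure set T -> \bar R}) (D : set T).
Hypothesis mD : measurable D.
Implicit Types (F G : T -> R[i]) (c : R[i]).

Definition cint F : R[i] :=
  Complex (\int[mu]_(t in D) complex.Re (F t)) (\int[mu]_(t in D) complex.Im (F t)).

Lemma finite_measure_lty : (mu D < +oo)%E.
Proof. by rewrite ltey_eq fin_num_measure. Qed.

Lemma bounded_integrable (h : T -> R) (B : R) : measurable_fun D h ->
  (forall t, D t -> `|h t| <= B) -> mu.-integrable D (EFin \o h).
Proof.
move=> mh hB; apply: measurable_bounded_integrable => //.
  exact: finite_measure_lty.
exists B; split; first exact: num_real.
by move=> x Bx t Dt /=; rewrite (le_trans (hB _ Dt))// ltW.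
Qed.

Lemma integrable_cst (r : R) : mu.-integrable D (fun=> r%:E).
Proof. by apply: (@bounded_integrable (cst r) `|r|) => //; exact: measurable_cst. Qed.

Lemma integrable_scale (c : R) (h : T -> R) : mu.-integrable D (EFin \o h) ->
  mu.-integrable D (EFin \o (fun t => c * h t)).
Proof.
move=> ih; rewrite (_ : _ \o _ = fun t => (c%:E * (h t)%:E)%E)//.
exact: integrableZl.
Qed.

Lemma bmeas_integrable F : bmeas D F ->
  mu.-integrable D (EFin \o (fun t => complex.Re (F t))) /\
  mu.-integrable D (EFin \o (fun t => complex.Im (F t))).
Proof.
move=> [F1 F2 [B FB]]; split; apply: (@bounded_integrable _ B) => // t Dt.
  by rewrite (le_trans (normRe_le_modulus _))// FB.
by rewrite (le_trans (normIm_le_modulus _))// FB.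
Qed.

Lemma eq_cint F G : (forall t, D t -> F t = G t) -> cint F = cint G.
Proof.
by move=> FG; congr Complex; apply: eq_Rintegral => t /set_mem Dt; rewrite FG.
Qed.

Lemma cintD F G : bmeas D F -> bmeas D G ->
  cint (fun t => F t + G t) = cint F + cint G.
Proof.
move=> /bmeas_integrable[F1 F2] /bmeas_integrable[G1 G2].
rewrite /cint; congr Complex; rewrite -RintegralD//; apply: eq_Rintegral => t _;
  by case: (F t) (G t) => ? ? [].
Qed.

Lemma cintZ c F : bmeas D F -> cint (fun t => c * F t) = c * cint F.
Proof.
move=> /bmeas_integrable[F1 F2]; case: c => a b.
have i1 x : mu.-integrable D (EFin \o (fun t => x * complex.Re (F t))).
  exact: integrable_scale.
have i2 x : mu.-integrable D (EFin \o (fun t => x * complex.Im (F t))).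
  exact: integrable_scale.
rewrite /cint; congr Complex; rewrite -!RintegralZl//.
  by rewrite -RintegralB//; apply: eq_Rintegral => t _; case: (F t).
by rewrite -RintegralD//; apply: eq_Rintegral => t _; case: (F t).
Qed.

Lemma cintB F G : bmeas D F -> bmeas D G ->
  cint (fun t => F t - G t) = cint F - cint G.
Proof.
move=> mF mG; rewrite -mulN1r -cintZ// -cintD//; last first.
  by apply: bmeasM => //; exact: bmeas_cst.
by apply: eq_cint => t _; rewrite mulN1r.
Qed.

Lemma cint_sum (F : nat -> T -> R[i]) n : (forall k, bmeas D (F k)) ->
  cint (fun t => \sum_(0 <= k < n) F k t) = \sum_(0 <= k < n) cint (F k).
Proof.
move=> mF; elim: n => [|n IH].
  rewrite big_geq// (@eq_cint _ (fun=> 0 * 0)) ?cintZ ?mul0r//; first exact: bmeas_cst.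
  by move=> t _; rewrite big_geq// mul0r.
rewrite big_nat_recr//= -IH -cintD//; last exact: bmeas_sum.
by apply: eq_cint => t _; rewrite big_nat_recr.
Qed.

Lemma cint_real (h : T -> R) :
  cint (fun t => (h t)%:C%C) = (\int[mu]_(t in D) h t)%:C%C.
Proof.
by rewrite /cint; congr Complex; rewrite /= Rintegral_cst// mul0r.
Qed.

(* The constant 2 comes from treating real and imaginary parts separately; it
   could be replaced by 1. *)
Lemma modulus_cint_le F (h : T -> R) : bmeas D F ->
  mu.-integrable D (EFin \o h) -> (forall t, D t -> modulus (F t) <= h t) ->
  modulus (cint F) <= 2 * \int[mu]_(t in D) h t.
Proof.
move=> mF ih Fh; have [F1 F2] := bmeas_integrable mF.
rewrite (le_trans (modulus_le_ReIm _))//= mulr_natl mulr2n; apply: lerD.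
- rewrite (le_trans (le_normr_Rintegral _ F1))//; apply: le_Rintegral => //.
    exact: (integrable_norm F1).
  by move=> t Dt; rewrite (le_trans (normRe_le_modulus _))// Fh.
- rewrite (le_trans (le_normr_Rintegral _ F2))//; apply: le_Rintegral => //.
    exact: (integrable_norm F2).
  by move=> t Dt; rewrite (le_trans (normIm_le_modulus _))// Fh.
Qed.

Lemma cvg_Rintegral (h : nat -> T -> R) (h' : T -> R) (g : T -> \bar R) :
  (forall n, measurable_fun D (h n)) -> measurable_fun D h' ->
  (forall t, D t -> h ^~ t @ \oo --> h' t) ->
  mu.-integrable D g -> (forall n t, D t -> (`|h n t|%:E <= g t)%E) ->
  \int[mu]_(t in D) h n t @[n --> \oo] --> \int[mu]_(t in D) h' t.
Proof.
move=> mh mh' hh' ig hg.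
have [|||||ih' _ h_cvg] := @dominated_convergence _ _ _ mu D mD
    (fun n => EFin \o h n) (EFin \o h') g.
- by move=> n; exact/measurable_EFinP.
- exact/measurable_EFinP.
- by apply: aeW => t Dt; apply/fine_cvgP; split; [exact: nearW|exact: hh'].
- by [].
- by apply: aeW => t n Dt; exact: hg.
have := @fine_cvg R _ _ _ _ (fine (\int[mu]_(t in D) (h' t)%:E)) _.
rewrite fineK; last exact: integrable_fin_num.
exact.
Qed.

Lemma cvg_cint (F : nat -> T -> R[i]) G (g : T -> \bar R) :
  (forall n, bmeas D (F n)) -> bmeas D G ->
  (forall t, D t -> F ^~ t @ \oo --> G t) ->
  mu.-integrable D g -> (forall n t, D t -> ((modulus (F n t))%:E <= g t)%E) ->
  cint (F n) @[n --> \oo] --> cint G.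
Proof.
move=> mF [G1 G2 _] FG ig Fg; apply/cvg_ReImP; split => /=.
- apply: (cvg_Rintegral _ _ _ ig) => // [n|t /FG/cvg_ReImP[]//|n t Dt].
    by have [] := mF n.
  by rewrite (le_trans _ (Fg n t Dt))// lee_fin normRe_le_modulus.
- apply: (cvg_Rintegral _ _ _ ig) => // [n|t /FG/cvg_ReImP[]//|n t Dt].
    by have [] := mF n.
  by rewrite (le_trans _ (Fg n t Dt))// lee_fin normIm_le_modulus.
Qed.

End complex_integral.

(** * The Cauchy transform of a measure on [0, 1) *)

Section disc_geometry.
Variable R : realType.
Implicit Types (z w h : R[i]) (t : R).

Lemma modulus_oneB_ge z : 1 - modulus z <= modulus (1 - z).
Proof. by rewrite -{1}(@modulus1 R) modulusB_ge. Qed.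

Lemma oneB_neq0 z : disc z -> 1 - z != 0.
Proof.
rewrite discE => z1; rewrite -modulus_eq0 gt_eqF//.
by rewrite (lt_le_trans _ (modulus_oneB_ge z))// subr_gt0.
Qed.

Lemma modulus_scale_le t z : t \in `[0, 1[%R -> modulus (t%:C%C * z) <= modulus z.
Proof.
rewrite in_itv/= => /andP[t0 t1].
by rewrite modulusM modulus_real ger0_norm// ler_piMl ?modulus_ge0// ltW.
Qed.

Lemma disc_scale t z : t \in `[0, 1[%R -> disc z -> disc (t%:C%C * z).
Proof. by move=> t01; rewrite !discE; apply: le_lt_trans; exact: modulus_scale_le. Qed.

Lemma geometricC_cvg z : disc z -> series (GRing.exp z) @ \oo --> (1 - z)^-1.
Proof.
move=> dz; have z0 := oneB_neq0 dz; apply/cvg_modulusP.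
have -> : (fun n => modulus (series (GRing.exp z) n - (1 - z)^-1)) =
    (fun n => modulus (1 - z)^-1 * modulus z ^+ n).
  apply/funext => n; rewrite -modulusX -modulusM -[in RHS]modulusN; congr modulus.
  have -> : series (GRing.exp z) n = (1 - z ^+ n) / (1 - z).
    apply: (mulIf z0); rewrite mulfVK// /series/= big_mkord mulrC -opprB mulNr.
    by rewrite -subrX1 opprB.
  by rewrite mulrBl mul1r addrAC subrr sub0r mulrC.
rewrite -[0](mulr0 (modulus (1 - z)^-1)); apply: cvgMr.
by apply: cvg_expr; rewrite ger0_norm ?modulus_ge0.
Qed.

Lemma near0_modulus (e : R) : 0 < e ->
  \forall h \near (0 : R[i])^', modulus h < e /\ h != 0.
Proof.
move=> e0; apply: filterI; last exact: nbhs_dnbhs_neq.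
apply: nbhs_dnbhs; have /cvg_modulusP/cvgrPdist_lt/(_ _ e0) := @cvg_id _ (nbhs (0 : R[i])).
by apply: filterS => h; rewrite sub0r normrN subr0 ger0_norm// modulus_ge0.
Qed.

End disc_geometry.

Section kernel.
Variable R : realType.
Variable mu : {finite_measure set (measurableTypeR R) -> \bar R}.
Local Notation D := (`[0, 1[%classic : set R).
Implicit Types (F : R -> R[i]) (z w h : R[i]) (t : R).

Lemma bmeas_id : bmeas D (fun t => t%:C%C).
Proof.
apply: (@bmeas_real _ _ _ _ id 1) => //.
by move=> t; rewrite /= in_itv/= => /andP[t0 /ltW t1]; rewrite ger0_norm.
Qed.

(** The kernel is a pointwise limit of polynomials in [t], the partial sums of its geometric series,
    and is bounded because [z] stays away from the circle. *)
Lemma bmeas_kernel z : disc z -> bmeas D (fun t => (1 - t%:C%C * z)^-1).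
Proof.
move=> dz; apply: (@bmeas_lim _ _ _ _ (fun n t => series (GRing.exp (t%:C%C * z)) n)
  _ (1 - modulus z)^-1).
- move=> n; apply: bmeas_sum => k; apply: bmeasX; apply: bmeasM; first exact: bmeas_id.
  exact: bmeas_cst.
- by move=> t Dt; apply: geometricC_cvg; exact: disc_scale.
- move=> t Dt; rewrite modulusV.
  have z1 : 0 < 1 - modulus z by rewrite subr_gt0.
  have le1 : 1 - modulus z <= modulus (1 - t%:C%C * z).
    by rewrite (le_trans _ (modulus_oneB_ge _))// lerB// modulus_scale_le.
  by rewrite lef_pV2 ?posrE// (lt_le_trans z1).
Qed.

Variable F : R -> R[i].
Hypothesis mF : bmeas D F.

Definition cmoment (n : nat) : R[i] := cint mu D (fun t => t%:C%C ^+ n * F t).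

Definition cauchyT (z : R[i]) : R[i] := cint mu D (fun t => F t * (1 - t%:C%C * z)^-1).

Definition cauchyT' (z : R[i]) : R[i] :=
  cint mu D (fun t => t%:C%C * F t * ((1 - t%:C%C * z)^-1) ^+ 2).

(** Termwise integration of the geometric series: for fixed [z] all partial sums are dominated by
    the constant [B / (1 - |z|)], integrable since [mu] is finite. *)
Lemma cauchyT_expansion z : disc z ->
  series (fun n => cmoment n * z ^+ n) @ \oo --> cauchyT z.
Proof.
move=> dz; have [_ _ [B FB]] := mF.
have mS n : bmeas D (fun t => t%:C%C ^+ n * F t).
  by apply: bmeasM => //; apply: bmeasX; exact: bmeas_id.
have mS' n : bmeas D (fun t => z ^+ n * (t%:C%C ^+ n * F t)).
  by apply: bmeasM => //; exact: bmeas_cst.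
have -> : series (fun n => cmoment n * z ^+ n) =
    (fun n => cint mu D (fun t => \sum_(0 <= k < n) z ^+ k * (t%:C%C ^+ k * F t))).
  apply/funext => n; rewrite cint_sum//; apply: eq_bigr => k _.
  by rewrite cintZ//; [exact: mulrC|exact: mS].
have E t n : \sum_(0 <= k < n) z ^+ k * (t%:C%C ^+ k * F t) =
    F t * series (GRing.exp (t%:C%C * z)) n.
  by rewrite /series/= mulr_sumr; apply: eq_bigr => k _; rewrite exprMn; ring.
have B0 : 0 <= B.
  by rewrite (le_trans (modulus_ge0 (F 0)))// FB//= in_itv/= lexx ltr01.
apply: (@cvg_cint _ _ _ _ _ _ _ _ (fun=> (B * (1 - modulus z)^-1)%:E)) => //.
- by move=> n; exact: bmeas_sum.
- by apply: bmeasM => //; exact: bmeas_kernel.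
- move=> t Dt; under [X in X @ _ --> _]funext do rewrite E.
  by apply: cvgMr; apply: geometricC_cvg; exact: disc_scale.
- exact: integrable_cst.
- move=> n t Dt; rewrite lee_fin E modulusM ler_pM ?modulus_ge0 ?FB//.
  rewrite (le_trans (modulus_sum _ _ _))//.
  apply: le_trans (_ : \sum_(0 <= k < n) modulus z ^+ k <= _).
    apply: ler_sum => k _; rewrite modulusX lerXn2r ?nnegrE ?modulus_ge0//.
    exact: modulus_scale_le.
  by rewrite (le_trans (geometric_tail_le _ _ _)) ?modulus_ge0// expr0 mul1r.
Qed.

(** Under the integral, the quotient minus its expected limit is exactly [h t^2 F(t) / ((1 - t z)^2
    (1 - t (h + z)))], which is [O(|h|)] uniformly in [t]. Agreement of [G] with the transform is
    asked on the disc only, where [hilbert_op] is meaningful. *)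
Lemma cauchyT_difference_quotient (G : R[i] -> R[i]) z : 
  (forall w, disc w -> G w = cauchyT w) -> disc z ->
  h^-1 *: (G (h + z) - G z) @[h --> 0^'] --> cauchyT' z.
Proof.
move=> Gc dz; have [_ _ [B FB]] := mF.
have B0 : 0 <= B.
  by rewrite (le_trans (modulus_ge0 (F 0)))// FB//= in_itv/= lexx ltr01.
have z1 : modulus z < 1 by [].
pose e := (1 - modulus z) / 2.
have e0 : 0 < e by rewrite divr_gt0// subr_gt0.
(* The 2 comes from [modulus_cint_le]; each of the three kernel factors is at most [1 / e] as soon
   as [|h| < e]. *)
pose K := 2 * (e ^- 3 * B * fine (mu D)).
apply/cvg_modulusP.
apply: (@squeeze_cvgr _ _ _ _ (cst 0) (fun h => K * modulus h)).
- have := near0_modulus e0; apply: filterS => h [he h0].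
  rewrite modulus_ge0/=.
  have dh : disc (h + z).
    by rewrite discE (le_lt_trans (modulusD _ _))//; move: he; rewrite /e; lra.
  have lb w t : modulus w <= modulus z + modulus h -> D t ->
      e <= modulus (1 - t%:C%C * w).
    move=> wz Dt; rewrite (le_trans _ (modulus_oneB_ge _))//.
    have := modulus_scale_le w Dt; move: he wz; rewrite /e; lra.
  rewrite !Gc//.
  have m1 : bmeas D (fun t => F t * (1 - t%:C%C * z)^-1).
    by apply: bmeasM => //; exact: bmeas_kernel.
  have m2 : bmeas D (fun t => F t * (1 - t%:C%C * (h + z))^-1).
    by apply: bmeasM => //; exact: bmeas_kernel.
  have m3 : bmeas D (fun t => t%:C%C * F t * (1 - t%:C%C * z)^-1 ^+ 2).
    apply: bmeasM; first by apply: bmeasM => //; exact: bmeas_id.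
    by apply: bmeasX; exact: bmeas_kernel.
  have m4 : bmeas D (fun t => h^-1 * (F t * (1 - t%:C%C * (h + z))^-1 - F t * (1 - t%:C%C * z)^-1)).
    by apply: bmeasM; [exact: bmeas_cst|exact: bmeasB].
  rewrite /cauchyT -cintB// -[_ *: _]/(_ * _) -cintZ//; last exact: bmeasB.
  rewrite -cintB//.
  rewrite /K -mulrA.
  have -> : e ^- 3 * B * fine (mu D) * modulus h =
    \int[mu]_(t in D) (e ^- 3 * B * modulus h).
    by rewrite Rintegral_cst// mulrAC.
  apply: modulus_cint_le => //; first exact: bmeasB.
    exact: integrable_cst.
  move=> t Dt.
  have n1 : 1 - t%:C%C * z != 0 by apply: oneB_neq0; exact: disc_scale.
  have n2 : 1 - t%:C%C * (h + z) != 0 by apply: oneB_neq0; exact: disc_scale.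
  have -> : h^-1 * (F t / (1 - t%:C%C * (h + z)) - F t / (1 - t%:C%C * z)) -
      t%:C%C * F t * (1 - t%:C%C * z)^-1 ^+ 2 =
      (1 - t%:C%C * z)^-1 ^+ 2 * (1 - t%:C%C * (h + z))^-1 * (F t * (h * (t%:C%C ^+ 2))).
    by field; rewrite h0 n1 n2.
  have lbV w : modulus w <= modulus z + modulus h -> modulus (1 - t%:C%C * w)^-1 <= e^-1.
    by move=> wz; rewrite modulusV lef_pV2 ?posrE ?(lt_le_trans e0)// lb.
  have [t0 t1] : 0 <= t /\ t <= 1 by move: Dt; rewrite /= in_itv/= => /andP[-> /ltW].
  have -> : e ^- 3 * B * modulus h = e^-1 ^+ 2 * e^-1 * (B * (modulus h * 1)).
    by rewrite mulr1 -exprSr exprVn mulrA.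
  rewrite !modulusM modulus_real ger0_norm// -!expr2.
  have V0 : 0 <= e^-1 by rewrite invr_ge0 ltW.
  apply: ler_pM; rewrite ?mulr_ge0 ?exprn_ge0 ?modulus_ge0//.
    apply: ler_pM; rewrite ?exprn_ge0 ?modulus_ge0//; last by rewrite lbV// addrC modulusD.
    by rewrite lerXn2r ?nnegrE ?modulus_ge0// lbV// lerDl modulus_ge0.
  apply: ler_pM; rewrite ?mulr_ge0 ?exprn_ge0 ?modulus_ge0 ?FB//.
  by rewrite ler_wpM2l ?modulus_ge0// exprn_ile1.
- exact: cvg_cst.
- suff : K * modulus h @[h --> (0 : R[i])^'] --> K * 0 by rewrite mulr0.
  apply: cvgMr; apply: cvg_trans (_ : modulus h @[h --> (0 : R[i])] --> 0).
    exact/cvg_app/cvg_within.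
  have /cvg_modulusP := @cvg_id _ (nbhs (0 : R[i])).
  by under [X in X @ _ --> _]funext do rewrite subr0.
Qed.

Lemma cauchyT_derivable (G : R[i] -> R[i]) z :
  (forall w, disc w -> G w = cauchyT w) -> disc z ->
  derivable G z 1 /\ derive1 G z = cauchyT' z.
Proof.
move=> Gc dz; have h := cauchyT_difference_quotient Gc dz; split.
  apply/cvg_ex; exists (cauchyT' z).
  apply: cvg_trans h; apply: near_eq_cvg; apply: nearW => h /=.
  by rewrite [h *: 1]mulr1.
exact: (cvg_lim _ h).
Qed.

End kernel.

(** * Carleson measures and their moments *)

Lemma integral_scaled_indic d (T : measurableType d) (R : realType)
    (mu : {measure set T -> \bar R}) (D A : set T) (c : R) :
  measurable D -> measurable A -> 0 <= c ->
  (\int[mu]_(t in D) (c * \1_A t)%:E = c%:E * mu (A `&` D))%E.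
Proof.
move=> mD mA c0; rewrite (@integralZl_indic _ _ _ mu D mD (fun=> A) c)//.
  by rewrite integral_indic.
by move=> h; have := lt_geF h; rewrite c0.
Qed.

Section carleson_moments.
Variable R : realType.
Variable mu : {finite_measure set (measurableTypeR R) -> \bar R}.
Local Notation D := (`[0, 1[%classic : set R).
Implicit Types (r t : R).

Definition carleson_bound (C : R) : Prop :=
  forall t, t \in `[0, 1[%R -> (mu `[t, 1%R[ <= (C * (1 - t))%:E)%E.

Lemma carleson_boundP : carleson mu 1 <-> exists2 C, 0 <= C & carleson_bound C.
Proof.
split.
  move=> h.
  pose s : \bar R := ereal_sup [set (mu `[t, 1%R[ * ((1 - t) `^ 1)^-1%:E)%E | t in `[0, 1[].
  have s_ge t : t \in `[0, 1[%R -> (mu `[t, 1%R[ * ((1 - t) `^ 1)^-1%:E <= s)%E.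
    by move=> t01; apply: ereal_sup_ubound; exists t.
  have s0 : (0 <= s)%E.
    apply: le_trans (s_ge 0 _); last by rewrite in_itv/= lexx ltr01.
    by rewrite mule_ge0// lee_fin invr_ge0 powR_ge0.
  have sfin : s \is a fin_num by rewrite ge0_fin_numE.
  exists (fine s); first exact: fine_ge0.
  move=> t t01; have := s_ge t t01.
  have t1 : 0 < 1 - t by move: t01; rewrite in_itv/= subr_gt0 => /andP[].
  by rewrite -[X in (_ <= X)%E](fineK sfin) powRr1 ?lee_pdivrMr ?(ltW t1).
move=> [C C0 hC]; apply: le_lt_trans (ltry C).
apply: ub_ereal_sup => _ [t t01 <-].
have t1 : 0 < 1 - t by move: t01; rewrite /= in_itv/= subr_gt0 => /andP[].
have -> : ((1 - t) `^ 1)^-1 = (1 - t)^-1 by rewrite powRr1// ltW.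
suff : (mu `[t, 1%R[ * ((1 - t)^-1)%:E <= C%:E)%E by [].
by rewrite lee_pdivrMr// -EFinM hC.
Qed.

Lemma measurable_power n : measurable_fun D (fun t => t ^+ n).
Proof. by apply: (@measurable_funX _ _ _ _ id). Qed.

Lemma integrable_power n : mu.-integrable D (EFin \o (fun t => t ^+ n)).
Proof.
apply: (@bounded_integrable _ _ _ _ _ _ _ 1) => //.
move=> t; rewrite /= in_itv/= => /andP[t0 /ltW t1].
by rewrite ger0_norm ?exprn_ge0// exprn_ile1.
Qed.

Lemma EFin_moment n : (moment mu n)%:E = (\int[mu]_(t in D) (t ^+ n)%:E)%E.
Proof.
by rewrite /moment /Rintegral fineK; last exact: integrable_fin_num (integrable_power n).
Qed.

(** Induction works on the exact value [4 - (2 n + 4) / 2 ^ n]. *)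
Lemma sum_succ_half n : \sum_(j < n) j.+1%:R * 2^-1 ^+ j <= 4 :> R.
Proof.
suff -> : \sum_(j < n) j.+1%:R * 2^-1 ^+ j = 4 - (n.*2 + 4)%:R * 2^-1 ^+ n :> R.
  by rewrite lerBlDr lerDl mulr_ge0// exprn_ge0.
elim: n => [|n IH]; first by rewrite big_ord0 expr0 mulr1 subrr.
rewrite big_ord_recr/= IH -!muln2 !natrD !natrM exprS -!natr1; by field.
Qed.

(* [t ^+ n <= exp (- n (1 - t))] decays geometrically on the grid of step [1 / n]
   to the left of 1, whose pieces have mass controlled by the Carleson bound. *)
Lemma power_le_step n t : (0 < n)%N -> t \in `[0, 1[%R ->
  t ^+ n <= \sum_(j < n) 2^-1 ^+ j * \1_(`[1 - j.+1%:R / n%:R, 1[%classic) t.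
Proof.
move=> n0; rewrite in_itv/= => /andP[t0 t1].
have nR : (0 : R) < n%:R by rewrite ltr0n.
have S0 (j : 'I_n) : 0 <= 2^-1 ^+ j * \1_(`[1 - j.+1%:R / n%:R, 1[%classic) t :> R.
  by rewrite mulr_ge0// exprn_ge0.
(* For [t = 0] one would have [x = n], and the grid index [truncn x] would fall outside ['I_n]. *)
have [->|tn0] := eqVneq t 0; first by rewrite expr0n gtn_eqF//= sumr_ge0.
pose x := n%:R * (1 - t).
have x0 : 0 <= x by rewrite mulr_ge0 ?subr_ge0// ltW.
have /andP[ix xi] := truncn_itv x0.
have iN : (Num.truncn x < n)%N.
  rewrite -(ltr_nat R) (le_lt_trans ix)// /x gtr_pMr// ltrBlDr ltrDl lt0r tn0//.
rewrite (bigD1 (Ordinal iN))//= -[leLHS]addr0 lerD ?sumr_ge0//.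
rewrite indicE mem_set ?mulr1; last first.
  rewrite /= in_itv/= t1 andbT lerBlDr -lerBlDl ler_pdivlMr// mulrC ltW//.
apply: (@le_trans _ _ (expR (- 1) ^+ Num.truncn x)).
  rewrite -expRM_natl; apply: (@le_trans _ _ (expR (- (1 - t)) ^+ n)).
    by rewrite lerXn2r ?nnegrE ?expR_ge0// (le_trans _ (expR_ge1Dx _))// opprB addrC subrK.
  by rewrite -expRM_natl ler_expR !mulrN mulr1 lerN2.
(* [exp (-1) <= 1/2], because [1 + 1 <= exp 1]. *)
rewrite lerXn2r ?nnegrE ?expR_ge0// expRN lef_pV2 ?posrE ?expR_gt0//.
exact: expR_ge1Dx.
Qed.

(** For an exponent [N > 0], the piece [j] has weight [2 ^- j] and mass at most [C (j + 1) / N], so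
    [sum_succ_half] yields [4 C / N]. Doubling the constant allows the denominator [N + 1], which
    also covers [N = 0]. *)
Lemma moment_le C n : 0 <= C -> carleson_bound C ->
  moment mu n <= 8 * C / n.+1%:R.
Proof.
move=> C0 hC; case: n => [|n].
  rewrite /moment; under eq_Rintegral do rewrite expr0.
  rewrite Rintegral_cst// mul1r divr1.
  have := hC 0; rewrite in_itv/= lexx ltr01 subr0 mulr1 => /(_ isT) h.
  apply: (@le_trans _ _ C); last by lra.
  by rewrite -lee_fin fineK// fin_num_measure.
have nR : (0 : R) < n.+1%:R by rewrite ltr0n.
apply: (@le_trans _ _ (4 * C / n.+1%:R)); last first.
  have -> : 4 * C / n.+1%:R = 8 * C / (n.+1%:R * 2).
    by move: nR; set x : R := n.+1%:R => nR; field; rewrite lt0r_neq0.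
  rewrite ler_wpM2l ?mulr_ge0// lef_pV2 ?posrE ?mulr_gt0//.
  by rewrite -natrM ler_nat muln2 -addnn addnS ltnS leq_addr.
rewrite -lee_fin EFin_moment.
pose A (j : nat) := `[1 - j.+1%:R / n.+1%:R, 1[%classic : set R.
have mA j : measurable (A j) by exact: measurable_itv.
have mI j : measurable_fun D (fun t => (2^-1 ^+ j * \1_(A j) t)%:E : \bar R).
  by apply/measurable_EFinP; apply: measurable_funM => //; exact: measurable_indic.
apply: (@le_trans _ _ (\int[mu]_(t in D) (\sum_(j < n.+1) (2^-1 ^+ j * \1_(A j) t)%:E))%E).
  apply: ge0_le_integral => //.
  - by move=> t; rewrite /= in_itv/= lee_fin => /andP[t0 _]; rewrite exprn_ge0.
  - by apply/measurable_EFinP; exact: measurable_power.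
  - by apply: emeasurable_sum => j; exact: mI.
  - by move=> t Dt; rewrite sumEFin lee_fin; exact: power_le_step.
rewrite ge0_integral_sum//; last first.
  by move=> j; exact: mI.
apply: (@le_trans _ _ (\sum_(j < n.+1) (2^-1 ^+ j * (C * (j.+1%:R / n.+1%:R)))%:E)%E).
  apply: lee_sum => j _.
  have -> := @integral_scaled_indic _ _ _ mu D (A j) (2^-1 ^+ j) _ (mA j) _ => //.
  rewrite EFinM lee_wpmul2l ?lee_fin ?exprn_ge0//.
  pose s : R := Num.max 0 (1 - j.+1%:R / n.+1%:R).
  have s01 : s \in `[0, 1[%R.
    by rewrite in_itv/= /s le_max lexx/= gt_max ltr01/= ltrBlDr ltrDl divr_gt0.
  apply: (@le_trans _ _ (mu `[s, 1%R[)).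
    apply: le_measure; rewrite ?inE//.
      by apply: measurableI; [exact: mA|exact: measurable_itv].
    move=> x []; rewrite /A/= !in_itv/= ge_max => /andP[a b] /andP[c _].
    by rewrite c b a.
  rewrite (le_trans (hC _ s01))// lee_fin ler_wpM2l// lerBlDr -lerBlDl.
  by rewrite /s le_max lexx orbT.
rewrite sumEFin lee_fin.
have := ler_wpM2l (_ : 0 <= C / n.+1%:R) (sum_succ_half n.+1).
rewrite divr_ge0// => /(_ isT); rewrite mulr_sumr.
move=> h; rewrite [4 * C]mulrC mulrAC; apply: le_trans h; apply: ler_sum => j _.
by rewrite le_eqVlt; apply/orP; left; apply/eqP; ring.
Qed.

End carleson_moments.

(** * The kernel [(1 - r t) ^- 2] against a Carleson measure *)

Section square_kernel.
Variable R : realType.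
Implicit Types (x q t : R).

(** Bernoulli's inequality for [(q / x) ^ n] with denominators cleared, where [(q - x) / x] is
    replaced by the smaller [q - x]. For [x < q < 1] it turns [n x ^ n] into a multiple of
    [q ^ n]. *)
Lemma exprn_mul_le x q n : 0 <= x -> x <= q -> q <= 1 ->
  x ^+ n * (1 + n%:R * (q - x)) <= q ^+ n.
Proof.
move=> x0 xq q1; have q0 : 0 <= q := le_trans x0 xq.
elim: n => [|n IH]; first by rewrite mul0r addr0 mulr1.
have h1 := ler_wpM2l x0 IH.
have h2 : x ^+ n.+1 <= q ^+ n.
  rewrite exprS -[leRHS]mul1r ler_pM ?exprn_ge0//.
    by rewrite (le_trans xq).
  by rewrite lerXn2r ?nnegrE.
have h3 : 0 <= q - x by rewrite subr_ge0.
have := ler_wpM2r h3 h2; rewrite !exprS -natr1 in h1 *.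
move: h1; set a := x ^+ n; set b := q ^+ n; set m := n%:R => h1 h4.
have -> : x * a * (1 + (m + 1) * (q - x)) = x * (a * (1 + m * (q - x))) + x * a * (q - x) by ring.
have -> : q * b = x * b + b * (q - x) by ring.
exact: lerD.
Qed.

Lemma cvg_natr_exprn x : 0 <= x -> x < 1 -> n%:R * x ^+ n @[n --> \oo] --> 0.
Proof.
move=> x0 x1; pose q := (1 + x) / 2.
have q1 : q < 1 by rewrite /q; lra.
have xq : x < q by rewrite /q; lra.
have d0 : 0 < q - x by rewrite subr_gt0.
apply: (@squeeze_cvgr _ _ _ _ (cst 0) (fun n => (q - x)^-1 * q ^+ n)).
- apply: nearW => n; rewrite mulr_ge0 ?exprn_ge0//= [leRHS]mulrC ler_pdivlMr//.
  have := exprn_mul_le n x0 (ltW xq) (ltW q1); apply: le_trans.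
  rewrite [leRHS]mulrDr mulr1 -[leLHS]add0r; apply: lerD; first exact: exprn_ge0.
  by rewrite le_eqVlt; apply/orP; left; apply/eqP; ring.
- exact: cvg_cst.
- suff : (q - x)^-1 * q ^+ n @[n --> \oo] --> (q - x)^-1 * 0 by rewrite mulr0.
  apply: cvgMr; apply: cvg_expr; rewrite ger0_norm//; exact: le_trans (ltW xq).
Qed.

Lemma sum_succ_expr x n :
  (1 - x) ^+ 2 * \sum_(0 <= k < n) k.+1%:R * x ^+ k =
  1 - x ^+ n * (1 + n%:R * (1 - x)).
Proof.
elim: n => [|n IH]; first by rewrite big_geq// mulr0 mul0r addr0 expr0 mulr1 subrr.
by rewrite big_nat_recr//= mulrDr IH [x ^+ n.+1]exprS -[n.+1%:R]natr1; ring.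
Qed.

Lemma sum_succ_expr_cvg x : 0 <= x -> x < 1 ->
  \sum_(0 <= k < n) k.+1%:R * x ^+ k @[n --> \oo] --> (1 - x) ^- 2.
Proof.
move=> x0 x1; have d0 : (1 - x) != 0 by rewrite subr_eq0 gt_eqF.
have -> : (fun n => \sum_(0 <= k < n) k.+1%:R * x ^+ k) =
    (fun n => (1 - x) ^- 2 * (1 - (x ^+ n + (1 - x) * (n%:R * x ^+ n)))).
  apply/funext => n; apply: (mulfI (_ : (1 - x) ^+ 2 != 0)); first by rewrite expf_neq0.
  by rewrite sum_succ_expr mulrA mulfV ?expf_neq0// mul1r; ring.
suff : (1 - x) ^- 2 * (1 - (x ^+ n + (1 - x) * (n%:R * x ^+ n))) @[n --> \oo]
     --> (1 - x) ^- 2 * (1 - (0 + (1 - x) * 0)) by rewrite mulr0 addr0 subr0 mulr1.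
apply: cvgMr; apply: cvgB; first exact: cvg_cst.
apply: cvgD; first by apply: cvg_expr; rewrite ger0_norm.
by apply: cvgMr; exact: cvg_natr_exprn.
Qed.

Lemma sum_succ_expr_le x n : 0 <= x -> x < 1 ->
  \sum_(0 <= k < n) k.+1%:R * x ^+ k <= (1 - x) ^- 2.
Proof.
move=> x0 x1; have d0 : 0 < 1 - x by rewrite subr_gt0.
rewrite -(ler_pM2l (exprn_gt0 2 d0)) sum_succ_expr mulfV ?lt0r_neq0 ?exprn_gt0//.
by rewrite lerBlDr lerDl mulr_ge0 ?exprn_ge0// addr_ge0// mulr_ge0// ltW.
Qed.

Lemma Rintegral_sum d (T : measurableType d) (mu : {measure set T -> \bar R}) (D : set T)
    (h : nat -> T -> R) (n : nat) : measurable D ->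
  (forall k, mu.-integrable D (EFin \o h k)) ->
  \int[mu]_(u in D) \sum_(0 <= k < n) h k u = \sum_(0 <= k < n) \int[mu]_(u in D) h k u.
Proof.
move=> mD ih; have iS m : mu.-integrable D (EFin \o (fun u => \sum_(0 <= k < m) h k u)).
  have := integrable_sum mD (index_iota 0 m) (P := xpredT) (fun i _ => ih i).
  by congr (mu.-integrable _ _); apply/funext => u; rewrite /= sumEFin.
elim: n => [|n IH].
  by under eq_Rintegral do rewrite big_geq//; rewrite big_geq// Rintegral_cst// mul0r.
under eq_Rintegral do rewrite big_nat_recr//=.
by rewrite RintegralD// IH big_nat_recr.
Qed.

Variable mu : {finite_measure set (measurableTypeR R) -> \bar R}.
Local Notation D := (`[0, 1[%classic : set R).

Lemma inv_square_measurable r : 0 <= r -> r < 1 ->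
  measurable_fun D (fun t => (1 - r * t) ^- 2).
Proof.
move=> r0 r1; apply: (@measurable_fun_cvg _ _ _ _
    (fun n t => \sum_(0 <= k < n) k.+1%:R * (r * t) ^+ k)).
  move=> n; apply: measurable_sum => k; apply: measurable_funM => //.
  by apply: measurable_funX; exact: measurable_funM.
move=> t; rewrite /= in_itv/= => /andP[t0 t1]; apply: sum_succ_expr_cvg; first exact: mulr_ge0.
by rewrite (le_lt_trans _ r1)// ler_piMr// ltW.
Qed.

Lemma inv_square_integrable r : 0 <= r -> r < 1 ->
  mu.-integrable D (EFin \o (fun t => (1 - r * t) ^- 2)).
Proof.
move=> r0 r1; apply: (@bounded_integrable _ _ _ _ _ _ _ ((1 - r) ^- 2)) => //.
  exact: inv_square_measurable.
move=> t; rewrite /= in_itv/= => /andP[t0 t1].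
have le1 : 1 - r <= 1 - r * t by rewrite lerB// ler_piMr// ltW.
have d0 : 0 < 1 - r by rewrite subr_gt0.
have d1 := lt_le_trans d0 le1.
rewrite normrV ?unitfE ?expf_neq0 ?gt_eqF// ger0_norm ?exprn_ge0 ?(ltW d1)//.
by rewrite lef_pV2 ?posrE ?exprn_gt0// lerXn2r// nnegrE ltW.
Qed.

(** In [(1 - r t) ^- 2 = \sum (k + 1) (r t) ^ k] the factor [k + 1] cancels the denominator of
    [moment_le], leaving the geometric series [8 C \sum r ^ k]. *)
Lemma inv_square_integral_le C r : 0 <= C -> carleson_bound mu C -> 0 <= r -> r < 1 ->
  \int[mu]_(t in D) (1 - r * t) ^- 2 <= 8 * C / (1 - r).
Proof.
move=> C0 hC r0 r1.
have rt t : D t -> 0 <= r * t /\ r * t <= r.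
  by rewrite /= in_itv/= => /andP[t0 /ltW t1]; rewrite mulr_ge0// ler_piMr.
have ip (k : nat) : mu.-integrable D (EFin \o (fun t => k.+1%:R * (r * t) ^+ k)).
  apply: (@bounded_integrable _ _ _ _ _ _ _ k.+1%:R) => //.
    apply: measurable_funM => //; apply: measurable_funX; exact: measurable_funM.
  move=> t /rt[t0 t1]; rewrite ger0_norm ?mulr_ge0 ?exprn_ge0// ler_piMr//.
  by rewrite exprn_ile1// (le_trans t1)// ltW.
have cv : \int[mu]_(t in D) \sum_(0 <= k < n) k.+1%:R * (r * t) ^+ k @[n --> \oo]
    --> \int[mu]_(t in D) (1 - r * t) ^- 2.
  apply: (@cvg_Rintegral _ _ _ _ _ _ _ _ (fun=> ((1 - r) ^- 2)%:E)) => //.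
  - move=> n; apply: measurable_sum => k; apply: measurable_funM => //.
    by apply: measurable_funX; exact: measurable_funM.
  - exact: inv_square_measurable.
  - move=> t /rt[t0 t1]; apply: sum_succ_expr_cvg => //.
    by rewrite (le_lt_trans t1).
  - exact: integrable_cst.
  - move=> n t /rt[t0 t1]; rewrite lee_fin ger0_norm; last first.
      by apply: sumr_ge0 => k _; rewrite mulr_ge0 ?exprn_ge0.
    apply: le_trans (sum_succ_expr_le n r0 r1); apply: ler_sum => k _.
    by rewrite ler_wpM2l// lerXn2r ?nnegrE.
rewrite -(cvg_lim _ cv)//; apply: limr_le.
  by apply/cvg_ex; exists (\int[mu]_(t in D) (1 - r * t) ^- 2).
apply: nearW => n; rewrite Rintegral_sum//.
apply: (@le_trans _ _ (\sum_(0 <= k < n) 8 * C * r ^+ k)); last first.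
  by rewrite -mulr_sumr ler_wpM2l ?mulr_ge0// (le_trans (geometric_tail_le _ _ _))// expr0 mul1r.
apply: ler_sum => k _.
under eq_Rintegral do rewrite exprMn mulrA.
rewrite RintegralZl//; last exact: integrable_power.
have := moment_le k C0 hC; rewrite ler_pdivlMr ?ltr0n// => h.
by rewrite mulrAC ler_wpM2r ?exprn_ge0// mulrC.
Qed.

(* On the disc, both [1 - t] and [|1 - z| / 2] are at most [|1 - t z|]. *)
Lemma cauchyT'_le (F : R -> R[i]) (M C : R) (z : R[i]) : bmeas D F ->
  (forall t, D t -> modulus (F t) <= M) -> 0 <= C -> carleson_bound mu C ->
  disc z -> modulus (cauchyT' mu F z) <= 128 * M * C / modulus (1 - z).
Proof.
move=> mF FM C0 hC dz.
have M0 : 0 <= M.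
  by rewrite (le_trans (modulus_ge0 (F 0)))// FM//= in_itv/= lexx ltr01.
have z1 : modulus z < 1 by [].
pose a := modulus (1 - z).
have a0 : 0 < a by rewrite lt0r modulus_ge0 modulus_eq0 oneB_neq0.
have a2 : a < 2.
  by rewrite (le_lt_trans (modulusD _ _))// modulusN modulus1; move: z1; lra.
(* Then [1 - r t = (1 - t) + t a / 2], where both terms are at most [|1 - t z|]: the complex kernel
   is controlled by the real one at [r]. *)
pose r := 1 - a / 2.
have r0 : 0 <= r by rewrite /r; move: a2; lra.
have r1 : r < 1 by rewrite /r; move: a0; lra.
have le1 t : D t -> (1 - r * t) / 2 <= modulus (1 - t%:C%C * z).
  move=> Dt; have [t0 t1] : 0 <= t /\ t < 1 by move: Dt; rewrite /= in_itv/= => /andP[].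
  have h1 : 1 - t <= modulus (1 - t%:C%C * z).
    rewrite (le_trans _ (modulus_oneB_ge _))// lerB// modulusM modulus_real ger0_norm//.
    by rewrite ler_piMr// ltW.
  have h2 : a <= modulus (1 - t%:C%C * z) + (1 - t).
    have -> : a = modulus (1 - t%:C%C * z - (1 - t)%:C%C * z).
      by congr modulus; rewrite rmorphB rmorph1; ring.
    rewrite (le_trans (modulusD _ _))// lerD2l modulusN modulusM modulus_real.
    by rewrite ger0_norm ?subr_ge0 ?(ltW t1)// ler_piMr ?subr_ge0 ?(ltW t1)// ltW.
  have h3 : a * t <= a by rewrite ler_piMr// ltW.
  rewrite /r; move: h1 h2 h3; lra.
apply: (@le_trans _ _ (2 * \int[mu]_(t in D) (4 * M * (1 - r * t) ^- 2))).
apply: modulus_cint_le => //.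
- apply: bmeasM; first by apply: bmeasM => //; exact: bmeas_id.
  by apply: bmeasX; exact: bmeas_kernel.
- by apply: integrable_scale => //; exact: inv_square_integrable.
- move=> t Dt; have [t0 t1] : 0 <= t /\ t < 1 by move: Dt; rewrite /= in_itv/= => /andP[].
  have rt : 0 < 1 - r * t by rewrite subr_gt0 (le_lt_trans _ t1)// ler_piMl// ltW.
  have rt2 : 0 < (1 - r * t) / 2 by rewrite divr_gt0.
  rewrite [leLHS]modulusM modulusX modulusV modulusM modulus_real ger0_norm//.
  rewrite [4 * M]mulrC -[leRHS]mulrA.
  apply: ler_pM; rewrite ?mulr_ge0 ?exprn_ge0 ?invr_ge0 ?modulus_ge0//.
    by rewrite -[leRHS]mul1r ler_pM ?modulus_ge0 ?FM// ltW.
  have -> : 4 * (1 - r * t) ^- 2 = ((1 - r * t) / 2)^-1 ^+ 2.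
    by rewrite invf_div expr_div_n; congr (_ / _); ring.
  rewrite lerXn2r ?nnegrE ?invr_ge0 ?modulus_ge0 ?(ltW rt2)//.
  by rewrite lef_pV2 ?posrE ?(lt_le_trans rt2) ?le1.
rewrite RintegralZl//; last exact: inv_square_integrable.
have := inv_square_integral_le C0 hC r0 r1.
have -> : 1 - r = a / 2 by rewrite /r; ring.
rewrite invf_div => /(ler_wpM2l (mulr_ge0 (ler0n R 4) M0)) h.
rewrite -/a.
(* The factors: 2 from [modulus_cint_le], 4 from squaring the halved kernel, 8 from
   [inv_square_integral_le], and 2 from [1 - r = a / 2]. *)
have -> : 128 * M * C / a = 2 * (4 * M * (8 * C * (2 / a))) by ring.
by rewrite ler_pM2l.
Qed.

End square_kernel.

(** * The Hilbert operator as a Cauchy transform *)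

Section hilbert_coefficients.
Variable R : realType.
Variable mu : {finite_measure set (measurableTypeR R) -> \bar R}.
Local Notation D := (`[0, 1[%classic : set R).
Implicit Types (t : R) (a : nat -> R[i]) (f : R[i] -> R[i]).

Lemma hilbert_series_cauchyT a (F : R -> R[i]) : bmeas D F ->
  (forall n, hilbert_coef mu a n = cmoment mu F n) ->
  forall z, disc z ->
    series (fun n => hilbert_coef mu a n * z ^+ n) @ \oo --> cauchyT mu F z.
Proof.
move=> mF aF z dz; rewrite (_ : (fun n => _) = (fun n => cmoment mu F n * z ^+ n)).
  exact: cauchyT_expansion.
by apply/funext => n; rewrite aF.
Qed.

Lemma moment_cmoment n (c : R[i]) :
  (moment mu n)%:C%C * c = cint mu D (fun t => c * t%:C%C ^+ n).
Proof.
have mp : bmeas D (fun t => t%:C%C ^+ n) by apply: bmeasX; exact: bmeas_id.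
rewrite (cintZ mu (measurable_itv _) c mp) mulrC; congr (_ * _).
rewrite /moment -cint_real; last exact: measurable_itv.
apply: eq_cint => t _; exact: (rmorphXn (real_complex R)).
Qed.

Lemma bmeas_expansion f a (M : R) : has_expansion f a ->
  (forall z, disc z -> modulus (f z) <= M) -> bmeas D (fun t => f t%:C%C).
Proof.
have dt t : D t -> disc t%:C%C.
  by rewrite /= in_itv/= => /andP[t0 t1]; rewrite disc_real.
move=> fa fM; apply: (@bmeas_lim _ _ _ _
    (fun n t => \sum_(0 <= k < n) a k * t%:C%C ^+ k) _ M).
- move=> n; apply: bmeas_sum => k; apply: bmeasM; first exact: bmeas_cst.
  by apply: bmeasX; exact: bmeas_id.
- by move=> t /dt/fa.
- by move=> t /dt/fM.
Qed.

(** Telescoping: [1 / x^2 <= 2 / x - 2 / (x + 1)] for [x >= 1]. *)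
Lemma sum_inv_square_le n : \sum_(0 <= k < n) k.+1%:R ^- 2 <= 2 :> R.
Proof.
apply: (@le_trans _ _ (2 - 2 / n.+1%:R)); last by rewrite lerBlDr lerDl divr_ge0.
elim: n => [|n IH]; first by rewrite big_geq// divr1 subrr.
rewrite big_nat_recr//=; move: (\sum_(_ <= _ < _) _) IH => S IH.
have n0 : (0 : R) < n.+1%:R by rewrite ltr0n.
have n1 : (n.+2%:R : R) = n.+1%:R + 1 by rewrite -natr1.
have x1 : (1 : R) <= n.+1%:R by rewrite ler1n.
rewrite n1; move: n0 x1 IH; move: (n.+1%:R) => x x0 x1 IH.
apply: (le_trans (lerD IH (lexx _))).
rewrite -subr_ge0.
have -> : 2 - 2 / (x + 1) - (2 - 2 / x + x ^- 2) = (x - 1) / (x ^+ 2 * (x + 1)).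
  by field; rewrite ?lt0r_neq0// addr_gt0.
by rewrite divr_ge0 ?subr_ge0// mulr_ge0 ?exprn_ge0 ?addr_ge0// ltW.
Qed.

(** By [x y <= (x^2 + y^2) / 2] with [x = |a_k|] and [y = 8 C / (k + 1)], the sum splits into two
    square sums, each already bounded. *)
Lemma sum_coef_moment_le f a (M C : R) n : has_expansion f a ->
  (forall z, disc z -> modulus (f z) <= M) -> 0 <= C -> carleson_bound mu C ->
  \sum_(0 <= k < n) modulus (a k) * moment mu k <= (M + 2) ^+ 2 + 64 * C ^+ 2.
Proof.
move=> fa fM C0 hC; have h1 := coef_square_summable n fa fM.
have h2 := sum_inv_square_le n.
apply: (@le_trans _ _ (\sum_(0 <= k < n)
    (2^-1 * modulus (a k) ^+ 2 + 32 * C ^+ 2 * k.+1%:R ^- 2))).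
  apply: ler_sum => k _.
  have h := moment_le k C0 hC.
  apply: (@le_trans _ _ (modulus (a k) * (8 * C / k.+1%:R))).
    by rewrite ler_wpM2l// modulus_ge0.
  set x := modulus (a k); set y := _ / _.
  have -> : 32 * C ^+ 2 * k.+1%:R ^- 2 = 2^-1 * y ^+ 2.
    rewrite /y expr_div_n exprMn; move: (k.+1%:R ^+ 2)^-1 (C ^+ 2) => w c; by field.
  have := sqr_ge0 (x - y); rewrite sqrrB; move: (x ^+ 2) (y ^+ 2) (x * y) => u v w.
  lra.
rewrite big_split/= -!mulr_sumr big_mkord.
have C20 : 0 <= 32 * C ^+ 2 by rewrite mulr_ge0// sqr_ge0.
have := ler_wpM2l C20 h2; move: h1.
move: (\sum_(i < n) _) (\sum_(0 <= i < n) _) ((M + 2) ^+ 2) (C ^+ 2) => u v w s.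
lra.
Qed.

(** By Tonelli the integral is [\sum |a_k| mu_k]. Keeping the series in the extended reals makes the
    exchange available before anything is known to be finite. *)
Lemma coef_majorant_integrable f a (M C : R) : has_expansion f a ->
  (forall z, disc z -> modulus (f z) <= M) -> 0 <= C -> carleson_bound mu C ->
  mu.-integrable D (fun t => \sum_(0 <= k <oo) (modulus (a k) * t ^+ k)%:E)%E.
Proof.
move=> fa fM C0 hC.
have ge0 k t : D t -> (0 <= (modulus (a k) * t ^+ k)%:E)%E.
  by rewrite /= in_itv/= lee_fin => /andP[t0 _]; rewrite mulr_ge0 ?modulus_ge0 ?exprn_ge0.
have mk k : measurable_fun D (fun t => (modulus (a k) * t ^+ k)%:E : \bar R).
  by apply/measurable_EFinP; apply: measurable_funM => //; exact: measurable_power.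
apply/integrableP; split.
  by apply: ge0_emeasurable_sum => [k t Dt _|k _]; [exact: ge0|exact: mk].
have -> : (\int[mu]_(t in D) `|\sum_(0 <= k <oo) (modulus (a k) * t ^+ k)%:E| =
    \int[mu]_(t in D) \sum_(0 <= k <oo) (modulus (a k) * t ^+ k)%:E)%E.
  apply: eq_integral => t /set_mem Dt; rewrite gee0_abs//.
  by apply: nneseries_ge0 => k _ _; exact: ge0.
rewrite integral_nneseries//.
apply: (@le_lt_trans _ _ ((M + 2) ^+ 2 + 64 * C ^+ 2)%:E); last exact: ltry.
apply: lime_le; first by apply: is_cvg_nneseries => k _ _; apply: integral_ge0 => t; exact: ge0.
apply: nearW => n; have := sum_coef_moment_le n fa fM C0 hC.
rewrite -lee_fin -sumEFin; apply: le_trans; apply: lee_sum => k _.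
rewrite EFinM EFin_moment -integralZl//; exact: integrable_power.
Qed.

(** Since [t ^ n <= 1], the same majorant [\sum |a_k| t ^ k] dominates the partial sums for every
    [n]. *)
Lemma hilbert_term_cvg f a (M C : R) n : has_expansion f a ->
  (forall z, disc z -> modulus (f z) <= M) -> 0 <= C -> carleson_bound mu C ->
  series (hilbert_term mu a n) @ \oo --> cmoment mu (fun t => f t%:C%C) n.
Proof.
move=> fa fM C0 hC; have mf := bmeas_expansion fa fM.
have mT k : bmeas D (fun t => a k * t%:C%C ^+ (n + k)).
  by apply: bmeasM; [exact: bmeas_cst|apply: bmeasX; exact: bmeas_id].
have -> : series (hilbert_term mu a n) =
    (fun N => cint mu D (fun t => \sum_(0 <= k < N) a k * t%:C%C ^+ (n + k))).
  apply/funext => N; rewrite cint_sum//; apply: eq_bigr => k _.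
  by rewrite -moment_cmoment.
have E t N : \sum_(0 <= k < N) a k * t%:C%C ^+ (n + k) =
    t%:C%C ^+ n * \sum_(0 <= k < N) a k * t%:C%C ^+ k.
  by rewrite mulr_sumr; apply: eq_bigr => k _; rewrite exprD mulrCA.
apply: cvg_cint (coef_majorant_integrable fa fM C0 hC) _ => //.
- by move=> N; exact: bmeas_sum.
- by apply: bmeasM => //; apply: bmeasX; exact: bmeas_id.
- move=> t; rewrite /= in_itv/= => /andP[t0 t1].
  under [X in X @ _ --> _]funext do rewrite E.
  by apply: cvgMr; apply: fa; rewrite disc_real.
- move=> N t; rewrite /= in_itv/= => /andP[t0 t1].
  apply: (@le_trans _ _ (\sum_(0 <= k < N) (modulus (a k) * t ^+ k)%:E)%E).
    rewrite sumEFin lee_fin E modulusM modulusX modulus_real ger0_norm//.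
    apply: (@le_trans _ _ (1 * modulus (\sum_(0 <= k < N) a k * t%:C%C ^+ k))).
      by rewrite ler_wpM2r ?modulus_ge0// exprn_ile1// ltW.
    rewrite mul1r (le_trans (modulus_sum _ _ _))//; apply: ler_sum => k _.
    by rewrite modulusM modulusX modulus_real ger0_norm.
  apply: nneseries_lim_ge => k _ _.
  by rewrite lee_fin mulr_ge0 ?modulus_ge0 ?exprn_ge0.
Qed.

End hilbert_coefficients.

(** * Area estimates *)

(** After extension by zero, every simple function below [f] is also below [g], so the suprema
    defining the two integrals compare without measurability. *)
Lemma le_integral_nonmeasurable d (T : measurableType d) (R : realType)
    (mu : {measure set T -> \bar R}) (D : set T) (f g : T -> \bar R) :
  (forall t, D t -> (0 <= f t)%E) -> (forall t, (0 <= g t)%E) ->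
  (forall t, D t -> (f t <= g t)%E) ->
  (\int[mu]_(t in D) f t <= \int[mu]_t g t)%E.
Proof.
move=> f0 g0 fg; rewrite integral_mkcond.
have f0' t : (0 <= (f \_ D) t)%E by apply: erestrict_ge0.
rewrite !ge0_integralTE//; apply: ereal_sup_le => _ [h hf <-].
exists h => // t.
apply: le_trans (hf t) _; rewrite patchE; case: ifPn => // /set_mem; exact: fg.
Qed.

Lemma ge_integral_nonmeasurable d (T : measurableType d) (R : realType)
    (mu : {measure set T -> \bar R}) (D : set T) (f g : T -> \bar R) :
  (forall t, D t -> (0 <= g t)%E) -> (forall t, (0 <= f t)%E) ->
  (forall t, ~ D t -> f t = 0%E) -> (forall t, D t -> (f t <= g t)%E) ->
  (\int[mu]_t f t <= \int[mu]_(t in D) g t)%E.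
Proof.
move=> g0 f0 fD fg; rewrite [leRHS]integral_mkcond.
have g0' t : (0 <= (g \_ D) t)%E by apply: erestrict_ge0.
rewrite !ge0_integralTE//; apply: ereal_sup_le => _ [h hf <-].
exists h => // t.
apply: le_trans (hf t) _; rewrite patchE; case: ifPn => [/set_mem/fg//|].
by rewrite notin_setE => /fD ->.
Qed.

(** * Decay of [1 - |sigma_w|^2] away from [w] *)

Section moebius.
Variable R : realType.
Implicit Types (z w : R[i]).

(** Clearing denominators leaves [|1 - w^* z|^2 - |w - z|^2 = (1 - |w|^2) (1 - |z|^2)], a polynomial
    identity in four real coordinates. *)
Lemma sigma_identity z w : disc w -> disc z ->
  1 - modulus (sigma w z) ^+ 2 =
  (1 - modulus w ^+ 2) * (1 - modulus z ^+ 2) / modulus (1 - (w^*)%C * z) ^+ 2.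
Proof.
move=> dw dz; have dwz : disc ((w^*)%C * z).
  rewrite discE modulusM.
  have -> : modulus (w^*)%C = modulus w by apply: complexI; rewrite -!modulusE normcJ.
  by rewrite mulr_ilt1// modulus_ge0.
have n0 := oneB_neq0 dwz.
have m0 : modulus (1 - (w^*)%C * z) ^+ 2 != 0 by rewrite expf_neq0// modulus_eq0.
rewrite /sigma modulusM modulusV exprMn exprVn.
apply: (mulIf m0); rewrite mulrBl mul1r !mulfVK//.
rewrite !sqr_modulus; case: w z {dw dz dwz n0 m0} => a b [c d] /=; ring.
Qed.

Lemma sqr_sigma_ge0_le1 z w : disc w -> disc z ->
  0 <= 1 - modulus (sigma w z) ^+ 2 <= 1.
Proof.
move=> dw dz; rewrite lerBlDr lerDl sqr_ge0 andbT sigma_identity//.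
have h (x : R[i]) : disc x -> 0 <= 1 - modulus x ^+ 2.
  by rewrite discE => x1; rewrite subr_ge0 exprn_ile1 ?modulus_ge0// ltW.
by rewrite !mulr_ge0 ?h// invr_ge0 sqr_ge0.
Qed.

Lemma oneB_sqr_modulus_le z : disc z -> 0 <= 1 - modulus z ^+ 2 <= 2 * modulus (1 - z).
Proof.
rewrite discE => z1; have z0 := modulus_ge0 z; have h := modulus_oneB_ge z.
have -> : 1 - modulus z ^+ 2 = (1 + modulus z) * (1 - modulus z) by ring.
apply/andP; split; first by rewrite mulr_ge0 ?subr_ge0 ?addr_ge0 ?(ltW z1).
have z2 : 0 <= 1 - modulus z by rewrite subr_ge0 ltW.
apply: ler_pM => //; lra.
Qed.

(** The numerator of [sigma_identity] is at most [2 |1 - w| * 2 |1 - z|], and [|1 - w^* z|] is at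
    least the difference of the two distances to 1. *)
Lemma sigma_decay z w : disc w -> disc z ->
  1 - modulus (sigma w z) ^+ 2 <=
  16 * Num.min (modulus (1 - w) / modulus (1 - z)) (modulus (1 - z) / modulus (1 - w)).
Proof.
move=> dw dz; set s := modulus (1 - w); set rho := modulus (1 - z).
have s0 : 0 < s by rewrite lt0r modulus_ge0 modulus_eq0 oneB_neq0.
have rho0 : 0 < rho by rewrite lt0r modulus_ge0 modulus_eq0 oneB_neq0.
have /andP[_ tau1] := sqr_sigma_ge0_le1 dw dz.
have /andP[w0 ws] := oneB_sqr_modulus_le dw.
have /andP[z0 zrho] := oneB_sqr_modulus_le dz.
have conjE (x : R[i]) : modulus (x^*)%C = modulus x by apply: complexI; rewrite -!modulusE normcJ.
have sE : modulus (1 - (w^*)%C) = s by rewrite /s -[RHS]conjE rmorphB rmorph1.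
have lb1 : rho - s <= modulus (1 - (w^*)%C * z).
  have -> : 1 - (w^*)%C * z = (1 - z) - - (z * (1 - (w^*)%C)) by ring.
  rewrite (le_trans _ (modulusB_ge _ _))// lerB// modulusN modulusM sE.
  by rewrite ler_piMl ?(ltW s0)// ltW.
have lb2 : s - rho <= modulus (1 - (w^*)%C * z).
  have -> : 1 - (w^*)%C * z = (1 - (w^*)%C) - - ((w^*)%C * (1 - z)) by ring.
  rewrite (le_trans _ (modulusB_ge _ _)) ?sE// lerB// modulusN modulusM conjE.
  by rewrite ler_piMl ?(ltW rho0)// ltW.
(* [x] and [y] stand for the two distances in either order. If [y < 2 x] the trivial bound 1 is
   enough; otherwise the denominator is at least [(y / 2)^2], and [4 x y / (y / 2)^2 = 16 x / y]. *)
have key x y : 0 < x -> 0 < y -> x * y = s * rho ->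
    y - x <= modulus (1 - (w^*)%C * z) ->
    1 - modulus (sigma w z) ^+ 2 <= 16 * (x / y).
  move=> x0 y0 xy lb; have [yx|xy2] := ltP y (2 * x).
    rewrite (le_trans tau1)// mulrA ler_pdivlMr// mul1r (le_trans (ltW yx))//.
    by rewrite ler_pM2r// ler_nat.
  have lb' : y / 2 <= modulus (1 - (w^*)%C * z) by apply: le_trans lb; lra.
  have y2 : 0 < y / 2 by rewrite divr_gt0.
  rewrite sigma_identity// ler_pdivrMr ?exprn_gt0// ?(lt_le_trans y2)//.
  apply: (@le_trans _ _ (2 * s * (2 * rho))); first exact: ler_pM.
  apply: (@le_trans _ _ (16 * (x / y) * (y / 2) ^+ 2)); last first.
    apply: ler_wpM2l; first by rewrite mulr_ge0// divr_ge0// ltW.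
    by rewrite lerXn2r ?nnegrE ?modulus_ge0// ltW.
  have -> : 16 * (x / y) * (y / 2) ^+ 2 = 4 * (x * y).
    by field; rewrite lt0r_neq0.
  by rewrite xy le_eqVlt; apply/orP; left; apply/eqP; ring.
by case: (leP (s / rho) (rho / s)) => _; apply: key => //; rewrite mulrC.
Qed.

End moebius.

Section dyadic.
Variable R : realType.
Implicit Types (x rho s : R).

Lemma dyadic_floor x : 1 <= x -> exists n, 2 ^+ n <= x < 2 ^+ n.+1.
Proof.
move=> x1; have x0 : 0 <= x := le_trans ler01 x1.
have /andP[Nx xN] := truncn_itv x0; set N := Num.truncn x in Nx xN.
have N0 : (0 < N)%N.
  by rewrite -ltnS -(ltr_nat R) (le_lt_trans x1).
exists (trunc_log 2 N); have /andP[h1 h2] := trunc_log_bounds (isT : (1 < 2)%N) N0.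
rewrite -!natrX (le_trans _ Nx) ?ler_nat//=.
by rewrite (lt_le_trans xN)// ler_nat.
Qed.

(** Outer radius of the [n]-th annulus, counted outwards from [s] if [b] holds and inwards
    otherwise; hence the shifted exponent in the first case only. *)
Definition dyadic_radius s (b : bool) n : R := if b then 2 ^+ n.+1 * s else 2 ^- n * s.

Lemma dyadic_radius_gt0 s b n : 0 < s -> 0 < dyadic_radius s b n.
Proof. by case: b => s0; rewrite mulr_gt0// ?invr_gt0 exprn_gt0. Qed.

Lemma dyadic_radiusP rho s : 0 < rho -> 0 < s -> exists n b,
  [/\ rho <= dyadic_radius s b n, dyadic_radius s b n <= 2 * rho
    & Num.min (s / rho) (rho / s) <= 2^-1 ^+ n].
Proof.
move=> rho0 s0; have [srho|rhos] := leP s rho.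
  have [|n /andP[h1 h2]] := @dyadic_floor (rho / s); first by rewrite ler_pdivlMr// mul1r.
  exists n, true; rewrite /dyadic_radius; split.
  - by rewrite -ler_pdivrMr// ltW.
  - by rewrite exprS -mulrA ler_pM2l// -ler_pdivlMr.
  - rewrite ge_min -[s / rho]invf_div exprVn lef_pV2 ?h1// ?posrE ?divr_gt0 ?exprn_gt0//.
have [|n /andP[h1 h2]] := @dyadic_floor (s / rho); first by rewrite ler_pdivlMr// mul1r ltW.
exists n, false; rewrite /dyadic_radius; split.
- by rewrite mulrC ler_pdivlMr ?exprn_gt0// mulrC -ler_pdivlMr.
- rewrite mulrC ler_pdivrMr ?exprn_gt0// -mulrA [rho * _]mulrC mulrA -exprS.
  by rewrite -ler_pdivrMr// ltW.
- rewrite ge_min -[rho / s]invf_div exprVn [X in _ || X]lef_pV2 ?h1 ?orbT//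
    ?posrE ?divr_gt0 ?exprn_gt0//.
Qed.

End dyadic.

Section squares.
Variable R : realType.
Implicit Types (z w : R[i]) (l : R).
Local Open Scope ereal_scope.

(** Squares stand in for discs: their product measure is immediate, and a square of half-side [l]
    lies between the discs of radii [l] and [2 l]. *)
Definition square z l : set (measurableTypeR R * measurableTypeR R) :=
  (`[complex.Re z - l, complex.Re z + l] `*` `[complex.Im z - l, complex.Im z + l])%R.

Lemma measurable_square z l : measurable (square z l).
Proof. by apply: measurableX; exact: measurable_itv. Qed.

Lemma dA_square z l : (0 < l)%R -> @dA R (square z l) = (4 * l ^+ 2)%:E.
Proof.
move=> l0.
have len c : (lebesgue_measure (`[c - l, c + l]%classic : set R) = (2 * l)%:E)%R.
  rewrite lebesgue_measure_itv/= lte_fin ltrBlDr -addrA ltrDl addr_gt0// -EFinB.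
  by congr EFin; ring.
transitivity ((2 * l)%:E * (2 * l)%:E); last by rewrite -EFinM; congr EFin; ring.
rewrite /dA /square product_measure1E; [|exact: measurable_itv..].
by congr (_ * _); exact: len.
Qed.

Lemma square_modulus z l x y : (0 < l)%R -> (modulus ((x +i* y)%C - z) <= l)%R -> square z l (x, y).
Proof.
move=> l0 h; have h1 := le_trans (normRe_le_modulus _) h.
have h2 := le_trans (normIm_le_modulus _) h.
case: z h h1 h2 => a b _ /=; rewrite !ler_norml => /andP[? ?] /andP[? ?].
by split => /=; rewrite in_itv/=; apply/andP; split; lra.
Qed.

Lemma modulus_square z l x y : square z l (x, y) -> (modulus ((x +i* y)%C - z) <= 2 * l)%R.
Proof.
move=> h; apply: le_trans (modulus_le_ReIm _) _.
case: z h => a b; rewrite /square/= !in_itv/= => -[/andP[? ?] /andP[? ?]].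
by rewrite mulr_natl mulr2n lerD// ler_norml; apply/andP; split; lra.
Qed.

End squares.

Section area_upper_bound.
Variable R : realType.
Implicit Types (z w : R[i]).

Lemma powR_exprn (x p : R) n : 0 <= x -> (x ^+ n) `^ p = (x `^ p) ^+ n.
Proof. by move=> x0; rewrite -powR_mulrn// -powRrM mulrC powRrM powR_mulrn// powR_ge0. Qed.

(* Around 1 the region [modulus (1 - z) ~ l] lies in a square of area [4 l ^ 2],
   and the integrand there is at most a constant times [q ^ n / l ^ 2], where
   [2 ^ n] is the ratio of [l] and [modulus (1 - w)]. *)
Lemma area_integral_kernel_le (p A : R) (G : R[i] -> R) w : 0 < p -> disc w ->
  (forall z, disc z -> 0 <= G z <= A / modulus (1 - z)) ->
  (area_integral (fun z => (G z ^+ 2 * (1 - modulus (sigma w z) ^+ 2) `^ p)%:E) <=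
  (32 * A ^+ 2 * 16 `^ p / (1 - 2^-1 `^ p))%:E)%E.
Proof.
move=> p0 dw hG; pose q : R := 2^-1 `^ p.
have q0 : 0 <= q by exact: powR_ge0.
have q1 : q < 1.
  have : q < 1 `^ p by rewrite gt0_ltr_powR ?nnegrE// invf_lt1// ltr1n.
  by rewrite powR1.
pose s := modulus (1 - w).
have s0 : 0 < s by rewrite lt0r modulus_ge0 modulus_eq0 oneB_neq0.
pose r b n := dyadic_radius s b n.
have r0 b n : 0 < r b n by exact: dyadic_radius_gt0.
(* On an annulus of outer radius [r], [|1 - z| >= r / 2] bounds [G] by [2 A / r], whose square gives
   the 4; [16 ^ p] comes from [sigma_decay]. *)
pose K : R := 4 * A ^+ 2 * 16 `^ p.
have K0 : 0 <= K by rewrite mulr_ge0 ?powR_ge0// mulr_ge0 ?sqr_ge0.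
pose c b n := K * q ^+ n / r b n ^+ 2.
have c0 b n : 0 <= c b n by rewrite divr_ge0 ?sqr_ge0// mulr_ge0// exprn_ge0.
pose B b n (u : measurableTypeR R * measurableTypeR R) : \bar R :=
  (c b n * \1_(square 1 (r b n)) u)%:E.
have B0 b n u : (0 <= B b n u)%E by rewrite lee_fin mulr_ge0.
have mB b n : measurable_fun setT (B b n).
  apply/measurable_EFinP; apply: measurable_funM => //.
  by apply: measurable_indic; exact: measurable_square.
(* Each point of the disc needs only one of these terms. Summing over all the squares gives a
   measurable majorant without partitioning the disc. *)
pose g u := (\sum_(0 <= n <oo) (B true n u + B false n u))%E.
apply: (@le_trans _ _ (\int[@dA R]_u g u)%E).
  apply: le_integral_nonmeasurable.
  - by move=> u _; rewrite lee_fin mulr_ge0 ?sqr_ge0 ?powR_ge0.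
  - by move=> u; apply: nneseries_ge0 => n _ _; rewrite adde_ge0.
  move=> [x y] /= dz; set z : R[i] := (x +i* y)%C.
  have rho0 : 0 < modulus (1 - z) by rewrite lt0r modulus_ge0 modulus_eq0 oneB_neq0.
  have [n [b [rho_r r_rho minn]]] := dyadic_radiusP rho0 s0.
  have Bz : ((G z ^+ 2 * (1 - modulus (sigma w z) ^+ 2) `^ p)%:E <= B b n (x, y))%E.
    rewrite /B indicE mem_set; last first.
      by apply: square_modulus => //; rewrite modulusBC.
    rewrite mulr1 lee_fin /c /K.
    have /andP[tau0 _] := sqr_sigma_ge0_le1 dw dz.
    have -> : 4 * A ^+ 2 * 16 `^ p * q ^+ n / r b n ^+ 2 =
        (2 * A / r b n) ^+ 2 * (16 `^ p * q ^+ n).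
      by field; rewrite lt0r_neq0.
    apply: ler_pM; rewrite ?sqr_ge0 ?powR_ge0//.
      have /andP[G0 GA] := hG z dz.
      have A0 : 0 <= A by have := le_trans G0 GA; rewrite pmulr_lge0// invr_gt0.
      have GAr : G z <= 2 * A / r b n.
        rewrite (le_trans GA)// ler_pdivrMr// mulrAC ler_pdivlMr//.
        by rewrite [2 * A]mulrC -mulrA ler_wpM2l.
      by rewrite lerXn2r ?nnegrE// (le_trans G0).
    have -> : 16 `^ p * q ^+ n = (16 * 2^-1 ^+ n) `^ p.
      by rewrite powRM ?exprn_ge0// powR_exprn.
    apply: ge0_ler_powR; rewrite ?nnegrE ?mulr_ge0 ?exprn_ge0 ?(ltW p0)//.
    by rewrite (le_trans (sigma_decay dw dz))// ler_pM2l.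
  apply: le_trans Bz _; rewrite /g (nneseriesD1 (n := n))//; last first.
    by move=> k _; rewrite adde_ge0.
  rewrite -[leLHS]adde0; apply: leeD; last first.
    by apply: nneseries_ge0 => k _ _; rewrite adde_ge0.
  by case: b {rho_r r_rho}; rewrite ?leeDl ?leeDr.
rewrite integral_nneseries//; last 2 first.
- by move=> n; exact: emeasurable_funD.
- by move=> n u _; rewrite adde_ge0.
apply: lime_le.
  by apply: is_cvg_nneseries => n _ _; apply: integral_ge0 => u _; rewrite adde_ge0.
apply: nearW => n.
(* The area [4 r^2] cancels the radius in [c]; the two families together contribute [8 K q ^ k]. *)
apply: (@le_trans _ _ (\sum_(0 <= k < n) (8 * K * q ^+ k)%:E)%E).
  apply: lee_sum => k _; rewrite ge0_integralD//.
  have IB b : (\int[@dA R]_u B b k u = (4 * K * q ^+ k)%:E)%E.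
    transitivity ((c b k)%:E * @dA R (square 1%R (r b k)))%E.
      by rewrite /B integral_scaled_indic ?setIT//; exact: measurable_square.
    rewrite dA_square// -EFinM; congr EFin; rewrite /c.
    by field; rewrite lt0r_neq0.
  by rewrite !IB -EFinD lee_fin; lra.
rewrite sumEFin lee_fin -mulr_sumr.
apply: le_trans (ler_wpM2l _ (geometric_tail_le q0 q1 (leq0n n))) _; first exact: mulr_ge0.
rewrite expr0 /K -/q; lra.
Qed.

End area_upper_bound.

(** * The two implications *)

Section sufficiency.
Variable R : realType.
Variable mu : {finite_measure set (measurableTypeR R) -> \bar R}.
Local Notation D := (`[0, 1[%classic : set R).

Lemma hilbert_op_cauchyT a (F : R -> R[i]) : bmeas D F ->
  (forall n, hilbert_coef mu a n = cmoment mu F n) ->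
  forall z, disc z -> hilbert_op mu a z = cauchyT mu F z.
Proof.
by move=> mF aF z dz; apply: cvg_lim => //; exact: hilbert_series_cauchyT.
Qed.

Lemma carleson_sufficient (p : R) : 0 < p -> carleson mu 1 ->
  hilbert_maps_Hinfty_into mu (Qspace p).
Proof.
move=> p0 /carleson_boundP[C C0 hC] f a [_ [M fM]] fa.
pose F (t : R) := f t%:C%C.
have mF : bmeas D F := bmeas_expansion fa fM.
have FM t : D t -> modulus (F t) <= M.
  by rewrite /= in_itv/= => /andP[t0 t1]; rewrite fM// disc_real.
have M0 : 0 <= M by rewrite (le_trans (modulus_ge0 (F 0)))// FM//= in_itv/= lexx ltr01.
have cF n : series (hilbert_term mu a n) @ \oo --> cmoment mu F n.
  exact: hilbert_term_cvg fa fM C0 hC.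
have aF n : hilbert_coef mu a n = cmoment mu F n by exact: cvg_lim.
have opE := hilbert_op_cauchyT mF aF.
have analytic_op : analytic (hilbert_op mu a).
  by move=> z dz; have [] := cauchyT_derivable mF opE dz.
split.
  split; last exact: analytic_op.
    by move=> n; apply/cvg_ex; exists (cmoment mu F n); exact: cF.
  move=> z dz; apply/cvg_ex; exists (cauchyT mu F z).
  exact: hilbert_series_cauchyT.
split; first exact: analytic_op.
pose A := 128 * M * C.
apply: (@le_lt_trans _ _ (32 * A ^+ 2 * 16 `^ p / (1 - 2^-1 `^ p))%:E); last exact: ltry.
apply: ub_ereal_sup => _ [w dw <-].
apply: area_integral_kernel_le => // z dz; rewrite modulus_ge0/=.
have [_ ->] := cauchyT_derivable mF opE dz.
exact: cauchyT'_le.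
Qed.

End sufficiency.

Section necessity.
Variable R : realType.
Variable mu : {finite_measure set (measurableTypeR R) -> \bar R}.
Local Notation D := (`[0, 1[%classic : set R).

Definition one_coef (k : nat) : R[i] := (k == 0%N)%:R.

Lemma one_coef_expansion : has_expansion (fun=> 1) one_coef.
Proof.
move=> z _; apply: cvg_near_cst; exists 1%N => // n /= n0.
rewrite /series/= -(prednK n0) big_nat_recl//= expr0 mulr1 big1_seq ?addr0// => k _.
by rewrite /one_coef mul0r.
Qed.

Lemma hilbert_coef_one n : hilbert_coef mu one_coef n = cmoment mu (fun=> 1) n.
Proof.
have -> : cmoment mu (fun=> 1) n = (moment mu n)%:C%C * 1.
  rewrite moment_cmoment; apply: eq_cint => t _; by rewrite mulrC.
apply: cvg_lim => //; apply: cvg_near_cst; exists 1%N => // m /= m0.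
rewrite /series/= -(prednK m0) big_nat_recl//= /hilbert_term addn0 big1_seq ?addr0// => k _.
by rewrite /one_coef mulr0.
Qed.

Lemma Re_inv_sqr (a b : R) :
  complex.Re ((Complex a b)^-1 ^+ 2) = (a ^+ 2 - b ^+ 2) / (a ^+ 2 + b ^+ 2) ^+ 2.
Proof.
(* At the origin both sides are 0, since the inverse of 0 is 0. *)
have [e|ab] := eqVneq (a ^+ 2 + b ^+ 2) 0.
  by rewrite expr2 /= e expr0n/= !(invr0, mulr0, mul0r, subrr, oppr0).
by rewrite expr2 /=; field.
Qed.

(* With [v := 1 - t r], the point [1 - t z] lies within [v / 8] of [v]. *)
Lemma Re_kernel_ge (r t : R) (z : R[i]) : 2^-1 <= r -> r < 1 -> t \in `[0, 1[%R ->
  modulus (z - r%:C%C) <= (1 - r) / 8 ->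
  ((1 - r) ^- 2 / 18) * \1_(`[r, 1[%classic) t <=
  complex.Re (t%:C%C * 1 * (1 - t%:C%C * z)^-1 ^+ 2).
Proof.
move=> r2 r1; rewrite in_itv/= => /andP[t0 t1] zr.
have h1 := le_trans (normRe_le_modulus _) zr.
have h2 := le_trans (normIm_le_modulus _) zr.
case: z zr h1 h2 => c d zr h1 h2.
have -> : complex.Re (t%:C%C * 1 * (1 - t%:C%C * (Complex c d))^-1 ^+ 2) =
    t * complex.Re ((Complex (1 - t * c) (- (t * d)))^-1 ^+ 2).
  rewrite mulr1; have -> : 1 - t%:C%C * Complex c d = Complex (1 - t * c) (- (t * d)).
    by apply/eqP; rewrite eq_complex /= !mul0r subr0 addr0 sub0r !eqxx.
  by case: (_ ^+ 2) => x y /=; rewrite mul0r subr0.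
rewrite Re_inv_sqr sqrrN.
pose v := 1 - t * r; pose a := 1 - t * c; pose b := t * d.
have d0 : 0 < 1 - r by rewrite subr_gt0.
have v1 : 1 - r <= v by rewrite /v lerB// ler_piMl ?(ltW t1)//; lra.
have v0 : 0 < v by exact: lt_le_trans v1.
move: h1 h2; rewrite /= subr0 !ler_norml => /andP[c1 c2] /andP[b1 b2].
have [tc1 tc2] : - (v / 8) <= t * (c - r) /\ t * (c - r) <= v / 8 by split; nra.
have [bv1 bv2] : - (v / 8) <= b /\ b <= v / 8 by rewrite /b; split; nra.
have av : 7 / 8 * v <= a by rewrite /a; move: tc2; rewrite /v; lra.
have av' : a <= 9 / 8 * v by rewrite /a; move: tc1; rewrite /v; lra.
(* [a^2 - b^2 >= (3/4) v^2] and [a^2 + b^2 <= (82/64) v^2]; the resulting ratio [(3/4) / (82/64)^2]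
   exceeds [4/9]. *)
have ker : 4 / 9 / v ^+ 2 <= (a ^+ 2 - b ^+ 2) / (a ^+ 2 + b ^+ 2) ^+ 2.
  have hb2 : b ^+ 2 <= v ^+ 2 / 64 by nra.
  have a2 : 49 / 64 * v ^+ 2 <= a ^+ 2 by nra.
  have a2' : a ^+ 2 <= 81 / 64 * v ^+ 2 by nra.
  have v2 : 0 < v ^+ 2 by rewrite exprn_gt0.
  have b20 : 0 <= b ^+ 2 by exact: sqr_ge0.
  move: (a ^+ 2) (b ^+ 2) (v ^+ 2) hb2 a2 a2' v2 b20 => A B V h3 h4 h5 V0 B0.
  rewrite ler_pdivrMr// mulrAC ler_pdivlMr; last by rewrite exprn_gt0//; lra.
  have h6 : A - B >= 3 / 4 * V by lra.
  have h7 : (A + B) ^+ 2 <= (82 / 64 * V) ^+ 2 by rewrite lerXn2r ?nnegrE//; lra.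
  nra.
have ker0 : 0 <= 4 / 9 / v ^+ 2 by rewrite divr_ge0 ?sqr_ge0.
rewrite -/a -/b indicE; case: (boolP (t \in _)) => [|_]; last first.
  by rewrite mulr0 mulr_ge0// (le_trans ker0).
rewrite inE/= in_itv/= => /andP[rt _]; rewrite mulr1.
(* On [[r, 1[], [t >= 1/2] and [v <= 1 - r^2 <= 2 (1 - r)], so the constant is
   [1/2 * 4/9 * 1/4 = 1/18]. *)
apply: (@le_trans _ _ (2^-1 * (4 / 9 / v ^+ 2))); last first.
  by apply: ler_pM => //; lra.
have vd : v <= 2 * (1 - r) by rewrite /v; nra.
have -> : 2^-1 * (4 / 9 / v ^+ 2) = (v / 2) ^- 2 / 18.
  by field; rewrite lt0r_neq0.
rewrite ler_pM2r// lef_pV2 ?posrE ?exprn_gt0//; last by lra.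
rewrite lerXn2r ?nnegrE//; lra.
Qed.

(** Real parts rather than moduli, because a pointwise lower bound on them survives integration. *)
Lemma Re_cauchyT'_ge (r : R) (z : R[i]) : 2^-1 <= r -> r < 1 ->
  disc z -> modulus (z - r%:C%C) <= (1 - r) / 8 ->
  fine (mu `[r, 1[) / (18 * (1 - r) ^+ 2) <= complex.Re (cauchyT' mu (fun=> 1) z).
Proof.
move=> r2 r1 dz zr.
have mr : measurable (`[r, 1[%classic : set R) by exact: measurable_itv.
have mK : bmeas D (fun t => t%:C%C * 1 * (1 - t%:C%C * z)^-1 ^+ 2).
  apply: bmeasM; first by apply: bmeasM; [exact: bmeas_id|exact: bmeas_cst].
  by apply: bmeasX; exact: bmeas_kernel.
pose c : R := (1 - r) ^- 2 / 18.
have c0 : 0 <= c by rewrite divr_ge0// invr_ge0 sqr_ge0.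
have -> : fine (mu `[r, 1[) / (18 * (1 - r) ^+ 2) =
    \int[mu]_(t in D) (c * \1_(`[r, 1[%classic) t).
  rewrite /Rintegral integral_scaled_indic// (_ : _ `&` _ = `[r, 1[%classic).
    rewrite fineM//= ?fin_num_measure// /c invfM; ring.
  apply/seteqP; split => [x []//|x rx]; split => //.
  move: rx; rewrite /= !in_itv/= => /andP[rx ->]; rewrite andbT; lra.
apply: le_Rintegral => //.
- apply: (@bounded_integrable _ _ _ _ _ _ _ c) => //.
    by apply: measurable_funM => //; exact: measurable_indic.
  move=> t Dt; rewrite indicE; case: (_ \in _); last by rewrite mulr0 normr0.
  by rewrite mulr1 ger0_norm.
- by have [] := bmeas_integrable mu (measurable_itv _) mK.
- by move=> t Dt; exact: Re_kernel_ge.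
Qed.

(** Writing [1 - r z = (1 - r^2) - r (z - r)] shows [|1 - r z| >= (7/8) (1 - r)], so [|sigma_r z|]
    is at most [1/7]. *)
Lemma sigma_small (r : R) (z : R[i]) : 0 <= r -> r < 1 -> disc z ->
  modulus (z - r%:C%C) <= (1 - r) / 8 -> 2^-1 <= 1 - modulus (sigma r%:C%C z) ^+ 2.
Proof.
move=> r0 r1 dz zr.
have -> : sigma r%:C%C z = (r%:C%C - z) / (1 - r%:C%C * z).
  by congr (_ / (1 - _ * z)); exact: conjc_real.
rewrite modulusM modulusV modulusBC.
have m0 : 7 / 8 * (1 - r) <= modulus (1 - r%:C%C * z).
  have -> : 1 - r%:C%C * z = (1 - r ^+ 2)%:C%C - r%:C%C * (z - r%:C%C).
    by rewrite rmorphB rmorph1 rmorphXn; ring.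
  rewrite (le_trans _ (modulusB_ge _ _))// modulusM !modulus_real !ger0_norm//; last first.
    by rewrite subr_ge0 exprn_ile1// ltW.
  have : r * modulus (z - r%:C%C) <= (1 - r) / 8.
    by rewrite (le_trans _ zr)// ler_piMl ?modulus_ge0// ltW.
  nra.
have d0 : 0 < 1 - r by rewrite subr_gt0.
have m1 : 0 < modulus (1 - r%:C%C * z) by apply: lt_le_trans m0; rewrite mulr_gt0.
have q : modulus (z - r%:C%C) / modulus (1 - r%:C%C * z) <= 2^-1.
  by rewrite ler_pdivrMr//; lra.
have q0 : 0 <= modulus (z - r%:C%C) / modulus (1 - r%:C%C * z).
  by rewrite divr_ge0 ?modulus_ge0.
nra.
Qed.

Lemma carleson_necessary (p : R) : 0 < p ->
  hilbert_maps_Hinfty_into mu (Qspace p) -> carleson mu 1.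
Proof.
move=> p0; have H1 : Hinfty (fun=> 1 : R[i]).
  split; first by move=> z _; exact: derivable_cst.
  by exists 1 => z _; rewrite modulus1.
move=> /(_ _ _ H1 one_coef_expansion)[_ [_ Qfin]].
have m1 : bmeas D (fun=> 1 : R[i]) by exact: bmeas_cst.
have opE := hilbert_op_cauchyT m1 hilbert_coef_one.
set g := hilbert_op mu one_coef in Qfin opE.
pose I w := area_integral (fun z =>
    (modulus (derive1 g z) ^+ 2 * (1 - modulus (sigma w z) ^+ 2) `^ p)%:E).
have I0 w : (0 <= I w)%E.
  by apply: integral_ge0 => u _; rewrite lee_fin mulr_ge0 ?sqr_ge0 ?powR_ge0.
have IQ w : disc w -> (I w <= Qnorm2 p g)%E.
  by move=> dw; apply: ereal_sup_ubound; exists w.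
have Q0 : (0 <= Qnorm2 p g)%E.
  by apply: le_trans (I0 0) (IQ 0 _); rewrite discE modulus0.
have Qf : Qnorm2 p g \is a fin_num by rewrite ge0_fin_numE.
pose K := fine (Qnorm2 p g).
have K0 : 0 <= K by exact: fine_ge0.
pose q : R := 2^-1 `^ p.
have q0 : 0 < q by rewrite powR_gt0.
pose m t := fine (mu `[t, 1[).
have mge0 t : 0 <= m t by rewrite fine_ge0.
(* The integrand is bounded below on the square of half-side [(1 - r) / 16], which fits in the disc
   of radius [(1 - r) / 8] of the pointwise estimates. *)
have key r : 2^-1 <= r -> r < 1 ->
    (m r / (18 * (1 - r) ^+ 2)) ^+ 2 * q * (4 * ((1 - r) / 16) ^+ 2) <= K.
  move=> r2 r1.
  have r0 : 0 <= r by lra.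
  have d0 : 0 < (1 - r) / 16 by rewrite divr_gt0// subr_gt0.
  have dr : disc r%:C%C by rewrite disc_real.
  rewrite -lee_fin /K fineK//; apply: le_trans (IQ _ dr).
  rewrite EFinM -(dA_square r%:C%C d0).
  pose S := square r%:C%C ((1 - r) / 16).
  pose c := (m r / (18 * (1 - r) ^+ 2)) ^+ 2 * q.
  have c0 : 0 <= c by rewrite mulr_ge0 ?sqr_ge0// ltW.
  have mS : measurable S by exact: measurable_square.
  have near_r x y : S (x, y) -> modulus (Complex x y - r%:C%C) <= (1 - r) / 8.
    by move=> /modulus_square; rewrite mulrCA (_ : 2 / 16 = 8^-1) //; field.
  have dS x y : S (x, y) -> disc (Complex x y).
    move=> /near_r h; rewrite discE -[Complex x y](subrK r%:C%C).
    by rewrite (le_lt_trans (modulusD _ _))// modulus_real ger0_norm//; lra.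
  have -> : (c%:E * @dA R S = \int[@dA R]_u (c * \1_S u)%:E)%E.
    by rewrite integral_scaled_indic// setIT.
  apply: ge_integral_nonmeasurable.
  - by move=> u _; rewrite lee_fin mulr_ge0 ?sqr_ge0 ?powR_ge0.
  - by move=> u; rewrite lee_fin mulr_ge0.
  - move=> [x y] /= nd; rewrite indicE memNset ?mulr0//.
    by move=> /dS.
  - move=> [x y] /= dz; rewrite lee_fin indicE; case: (boolP (_ \in _)) => [|_]; last first.
      by rewrite mulr0 mulr_ge0 ?sqr_ge0 ?powR_ge0.
    rewrite inE => /near_r h; rewrite mulr1.
    have [_ ->] := cauchyT_derivable m1 opE dz.
    apply: ler_pM; rewrite ?sqr_ge0 ?(ltW q0)//.
      have mr0 : 0 <= m r / (18 * (1 - r) ^+ 2).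
        by rewrite divr_ge0// mulr_ge0// sqr_ge0.
      rewrite lerXn2r ?nnegrE ?modulus_ge0//.
      apply: le_trans (Re_cauchyT'_ge r2 r1 dz h) _.
      by rewrite (le_trans (ler_norm _))// normRe_le_modulus.
    have sm := sigma_small r0 r1 dz h.
    by apply: ge0_ler_powR => //; rewrite ?nnegrE ?(ltW p0)// (le_trans _ sm).
apply/carleson_boundP.
(* In [key] the powers of [1 - r] combine to [(m r / (1 - r))^2 * q * 4 / (18 * 16)^2], and
   [18 * 16 / 2 = 144]. *)
pose L : R := 144 * Num.sqrt (K / q).
(* The second term handles [t < 1/2], where [2 (1 - t) > 1] and the total mass suffices. *)
pose C := L + 2 * fine (mu setT).
have L0 : 0 <= L by rewrite mulr_ge0// sqrtr_ge0.
have T0 : 0 <= fine (mu setT) by exact: fine_ge0.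
have mT t : m t <= fine (mu setT).
  by rewrite fine_le ?fin_num_measure// le_measure ?inE//; exact: measurable_itv.
exists C; first by rewrite addr_ge0// mulr_ge0.
move=> t; rewrite in_itv/= => /andP[t0 t1].
have -> : mu `[t, 1[ = (m t)%:E by rewrite fineK// fin_num_measure//; exact: measurable_itv.
rewrite lee_fin mulrDl.
have d0 : 0 < 1 - t by rewrite subr_gt0.
have [t2|t2] := ltP t 2^-1.
  have := mT t; have : 0 <= L * (1 - t) by rewrite mulr_ge0// ltW.
  nra.
suff h : m t <= L * (1 - t).
  by rewrite (le_trans h)// lerDl mulr_ge0 ?mulr_ge0// ltW.
pose x := 144^-1 * (m t / (1 - t)).
have x0 : 0 <= x by rewrite mulr_ge0// divr_ge0// ltW.
have xK : x ^+ 2 <= K / q.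
  rewrite ler_pdivlMr//; apply: le_trans (key t t2 t1).
  rewrite le_eqVlt; apply/orP; left; apply/eqP; rewrite /x.
  by field; rewrite lt0r_neq0.
have : x <= Num.sqrt (K / q) by rewrite -(ger0_norm x0) -sqrtr_sqr ler_wsqrtr.
by rewrite /x ler_pdivrMl// ler_pdivrMr.
Qed.

End necessity.

Theorem theorem3p6 (R : realType) (p : R) (p_gt0 : 0 < p) (p_lt2 : p < 2)
  (mu : {finite_measure set (measurableTypeR R) -> \bar R})
  (mu_supp : mu (~` `[0%R, 1%R[) = 0%E) :
  hilbert_maps_Hinfty_into mu (Qspace p) <-> carleson mu 1.
Proof.
by split; [exact: carleson_necessary|exact: carleson_sufficient].
Qed.
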